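(* Let $E,F$ be Hilbert spaces, let $\mathcal B'\subset\mathbb R^p$ be open, let $\mathcal B\subset\mathcal B'$ be compact, and for every $m\in\mathcal B'$ let $A_m:E\to F$ be a compact linear operator such that $m\mapsto A_m$ is of class $C^1$ on $\mathcal B'$. Assume that the following two conditions hold. (1) For any $m,m'\in\mathcal B'$ and any $\varphi,\psi\in E$: if $\varphi\neq 0$ and $A_m\varphi=A_{m'}\psi$, then $m=m'$ and $\varphi=\psi$. (2) For every $m\in\mathcal B'$ and every $q\in\mathbb R^p$ with $|q|=1$, the linear operator $T:E\times E\to F$, $T(\varphi,\psi)=\partial_qA_m\varphi+A_m\psi$, is injective. Fix a positive integer $N$ and, for each $m\in\mathcal B$, let $E_{m,N}\subset E$ be a subspace spanned by first singular vectors of $A_m$ in the sense of the context (in particular $\dim E_{m,N}=N$). Then there is a constant $C>0$ such that for all $m,m'\in\mathcal B$, all $\varphi\in E_{m,N}$ and all $\psi\in E_{m',N}$, $$\|A_m\varphi-A_{m'}\psi\|\ \ge\ C\big(\|\psi\|\,|m-m'|+\|\varphi-\psi\|\big).$$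
   Context: Regularity of $m\mapsto A_m$ is with respect to the operator norm on bounded linear operators $E\to F$, and $\partial_qA_m$ denotes the derivative of $m\mapsto A_m$ at $m$ in the direction $q\in\mathbb R^p$. The Hilbert spaces may be real or complex (in the complex case differentiation is understood over $\mathbb R$). For $m\in\mathcal B'$ let $\lambda_1^2(m)>\lambda_2^2(m)>\dots$ be the distinct eigenvalues of the compact nonnegative self-adjoint operator $A_m^*A_m$, in decreasing order. For a fixed positive integer $N$ (such that $N$-dimensional subspaces as below exist) and $m\in\mathcal B$, $E_{m,N}$ denotes a subspace of $E$ with $\dim E_{m,N}=N$ such that either $$E_{m,N}\subset \operatorname{Ker}(A_m^*A_m-\lambda_1^2(m)I),$$ or, for some integer $r$, $$\sum_{j=1}^{r-1}\operatorname{Ker}(A_m^*A_m-\lambda_j^2(m)I)\ \subset\ E_{m,N}\ \subset\ \sum_{j=1}^{r}\operatorname{Ker}(A_m^*A_m-\lambda_j^2(m)I).$$ One such subspace is chosen for each $m\in\mathcal B$. *)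

(* Defs.v *)
From HB Require Import structures.
From mathcomp Require Import all_boot all_order all_algebra.
From mathcomp Require Import sesquilinear complex.
From mathcomp Require Import boolp classical_sets functions cardinality reals.
From mathcomp Require Import topology normedtype derive.

Set Implicit Arguments.
Unset Strict Implicit.
Unset Printing Implicit Defensive.

Import Order.TTheory GRing.Theory Num.Theory.
Import numFieldNormedType.Exports.

Local Open Scope classical_set_scope.
Local Open Scope ring_scope.

Variant scalar_kind := RealScalars | ComplexScalars.

Definition scalar (R : realType) (k : scalar_kind) : numFieldType :=
  match k with
  | RealScalars => R : numFieldType
  | ComplexScalars => R[i] : numFieldType
  end.

Definition scalar_of_real (R : realType) (k : scalar_kind) : R -> scalar R k :=
  match k with
  | RealScalars => id
  | ComplexScalars => fun a => Complex a 0
  end.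

Definition scalar_re (R : realType) (k : scalar_kind) : scalar R k -> R :=
  match k with
  | RealScalars => id
  | ComplexScalars => @complex.Re R
  end.

Definition scalar_conj (R : realType) (k : scalar_kind) :
    scalar R k -> scalar R k :=
  match k with
  | RealScalars => id
  | ComplexScalars => @conjc R
  end.

Section scalar_theory.
Context {R : realType} {k : scalar_kind}.
Local Notation K := (scalar R k).
Local Notation "a %:K" := (@scalar_of_real R k a) (at level 2).
Local Notation re := (@scalar_re R k).

Lemma scalar_of_real0 : 0%:K = 0.
Proof. by case: k. Qed.

Lemma scalar_of_real1 : 1%:K = 1.
Proof. by case: k. Qed.

Lemma scalar_of_realD a b : (a + b)%:K = a%:K + b%:K.
Proof. by case: k => //=; apply/eqP; rewrite eq_complex /= addr0 !eqxx. Qed.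

Lemma scalar_of_realM a b : (a * b)%:K = a%:K * b%:K.
Proof.
case: k => //=; apply/eqP; rewrite eq_complex /=.
by rewrite !mul0r !mulr0 subr0 addr0 !eqxx.
Qed.

Lemma norm_scalar_of_real a : `|a%:K| = `|a|%:K.
Proof. by case: k => //=; rewrite normc_def /= expr0n addr0 sqrtr_sqr. Qed.

Lemma ler_scalar_of_real a b : (a%:K <= b%:K) = (a <= b).
Proof. by case: k => //=; rewrite lecE /= eqxx. Qed.

Lemma scalar_of_realK a : re (a%:K) = a.
Proof. by case: k. Qed.

Lemma scalar_reK (x : K) : 0 <= x -> (re x)%:K = x.
Proof.
case: k x => //= x x0; apply/eqP; rewrite eq_complex /= eqxx /=.
by rewrite (ger0_Im x0).
Qed.

End scalar_theory.

HB.mixin Record isHilbert (R : realType) (k : scalar_kind) E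
    & CompleteNormedModule (scalar R k) E := {
  inner : {dot E for @scalar_conj R k} ;
  inner_norm : forall x : E, `|x| ^+ 2 = inner x x
}.

#[short(type="hilbertType")]
HB.structure Definition Hilbert (R : realType) (k : scalar_kind) :=
  { E of CompleteNormedModule (scalar R k) E & isHilbert R k E }.

(* `|x| is an element of scalar R k, rnorm x is the same number in R *)
Definition rnorm {R : realType} {k : scalar_kind}
  {E : normedModType (scalar R k)} (x : E) : R := scalar_re `|x|.

Section rnorm_theory.
Context {R : realType} {k : scalar_kind} {E : normedModType (scalar R k)}.
Implicit Types x y : E.

Lemma rnormE x : scalar_of_real k (rnorm x) = `|x|.
Proof. exact: scalar_reK. Qed.

Lemma rnorm_ge0 x : 0 <= rnorm x.
Proof. by rewrite -(@ler_scalar_of_real R k) rnormE scalar_of_real0. Qed.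

Lemma rnormD x y : rnorm (x + y) <= rnorm x + rnorm y.
Proof.
by rewrite -(@ler_scalar_of_real R k) scalar_of_realD !rnormE ler_normD.
Qed.

Lemma rnormZ (a : scalar R k) x : rnorm (a *: x) = scalar_re `|a| * rnorm x.
Proof.
rewrite -[RHS](@scalar_of_realK R k) scalar_of_realM rnormE scalar_reK //.
by rewrite -normrZ.
Qed.

Lemma rnormZr (a : R) x : rnorm (scalar_of_real k a *: x) = `|a| * rnorm x.
Proof. by rewrite rnormZ norm_scalar_of_real scalar_of_realK. Qed.

Lemma rnormN x : rnorm (- x) = rnorm x.
Proof. by rewrite /rnorm normrN. Qed.

Lemma rnorm0 : rnorm (0 : E) = 0.
Proof. by rewrite /rnorm normr0 -scalar_of_real0 scalar_of_realK. Qed.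

Lemma rnorm0_eq0 x : rnorm x = 0 -> x = 0.
Proof.
by move=> x0; apply/normr0_eq0; rewrite -rnormE x0 scalar_of_real0.
Qed.

End rnorm_theory.

Section bounded_operators.
Context {R : realType} {k : scalar_kind}.
Variables E F : normedModType (scalar R k).

Definition bounded_linear (f : E -> F) : Prop :=
  (forall (a : scalar R k) x y, f (a *: x + y) = a *: f x + f y) /\
  exists M : R, forall x, rnorm (f x) <= M * rnorm x.

Record boundedOp := BoundedOp {
  boundedOp_fun :> E -> F ;
  boundedOpP : bounded_linear boundedOp_fun }.

HB.instance Definition _ := gen_eqMixin boundedOp.
HB.instance Definition _ := gen_choiceMixin boundedOp.

Lemma boundedOp_ext (f g : boundedOp) : f =1 g -> f = g.
Proof.
case: f g => [f Pf] [g Pg] /= /funext fg; rewrite fg in Pf *.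
by rewrite (Prop_irrelevance Pf Pg).
Qed.

Lemma boundedOp_linear (f : boundedOp) (a : scalar R k) x y :
  f (a *: x + y) = a *: f x + f y.
Proof. exact: (boundedOpP f).1. Qed.

Lemma bounded_linear0 : bounded_linear (fun=> 0).
Proof.
split=> [a x y|]; first by rewrite scaler0 addr0.
by exists 0 => x; rewrite rnorm0 mul0r.
Qed.

Lemma bounded_linearN (f : boundedOp) : bounded_linear (fun x => - f x).
Proof.
split=> [a x y|]; first by rewrite boundedOp_linear opprD scalerN.
by have [_ [M fM]] := boundedOpP f; exists M => x; rewrite rnormN.
Qed.

Lemma bounded_linearD (f g : boundedOp) : bounded_linear (fun x => f x + g x).
Proof.
split=> [a x y|]; first by rewrite !boundedOp_linear scalerDr addrACA.
have [_ [M fM]] := boundedOpP f; have [_ [N gN]] := boundedOpP g.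
by exists (M + N) => x; rewrite mulrDl (le_trans (rnormD _ _))// lerD.
Qed.

Lemma bounded_linearZ (a : R) (f : boundedOp) :
  bounded_linear (fun x => scalar_of_real k a *: f x).
Proof.
split=> [b x y|].
  by rewrite boundedOp_linear scalerDr !scalerA mulrC.
have [_ [M fM]] := boundedOpP f.
by exists (`|a| * M) => x; rewrite rnormZr -mulrA ler_wpM2l.
Qed.

Definition boundedOp0 := BoundedOp bounded_linear0.
Definition boundedOpN f := BoundedOp (bounded_linearN f).
Definition boundedOpD f g := BoundedOp (bounded_linearD f g).
Definition boundedOpZ a f := BoundedOp (bounded_linearZ a f).

Lemma boundedOp_addA : associative boundedOpD.
Proof. by move=> f g h; apply: boundedOp_ext => x /=; rewrite addrA. Qed.

Lemma boundedOp_addC : commutative boundedOpD.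
Proof. by move=> f g; apply: boundedOp_ext => x /=; rewrite addrC. Qed.

Lemma boundedOp_add0 : left_id boundedOp0 boundedOpD.
Proof. by move=> f; apply: boundedOp_ext => x /=; rewrite add0r. Qed.

Lemma boundedOp_addN : left_inverse boundedOp0 boundedOpN boundedOpD.
Proof. by move=> f; apply: boundedOp_ext => x /=; rewrite addNr. Qed.

HB.instance Definition _ := GRing.isZmodule.Build boundedOp
  boundedOp_addA boundedOp_addC boundedOp_add0 boundedOp_addN.

Lemma boundedOp_scaleA (a b : R) (f : boundedOp) :
  boundedOpZ a (boundedOpZ b f) = boundedOpZ (a * b) f.
Proof.
by apply: boundedOp_ext => x /=; rewrite scalerA scalar_of_realM.
Qed.

Lemma boundedOp_scale1 : left_id (1 : R) boundedOpZ.
Proof.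
by move=> f; apply: boundedOp_ext => x /=; rewrite scalar_of_real1 scale1r.
Qed.

Lemma boundedOp_scaleDr : right_distributive boundedOpZ +%R.
Proof. by move=> a f g; apply: boundedOp_ext => x /=; rewrite scalerDr. Qed.

Lemma boundedOp_scaleDl (f : boundedOp) :
  {morph boundedOpZ^~ f : a b / a + b}.
Proof.
by move=> a b; apply: boundedOp_ext => x /=; rewrite scalar_of_realD scalerDl.
Qed.

(* also when the scalars are complex, boundedOp is a module over R : operator
   valued functions are differentiated with respect to real variables *)
HB.instance Definition _ := GRing.Zmodule_isLmodule.Build R boundedOp
  boundedOp_scaleA boundedOp_scale1 boundedOp_scaleDr boundedOp_scaleDl.

Definition opnorm (f : boundedOp) : R :=
  sup [set rnorm (f x) | x in [set x : E | rnorm x <= 1]].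

Lemma boundedOp0E (f : boundedOp) : f 0 = 0.
Proof.
have := boundedOp_linear f 1 0 0; rewrite !scale1r addr0.
by move=> /(congr1 (fun y => y - f 0)); rewrite subrr addrK.
Qed.

Lemma boundedOp_scalable (f : boundedOp) (a : scalar R k) x :
  f (a *: x) = a *: f x.
Proof. by have := boundedOp_linear f a x 0; rewrite boundedOp0E !addr0. Qed.

Lemma opnorm_has_sup (f : boundedOp) :
  has_sup [set rnorm (f x) | x in [set x : E | rnorm x <= 1]].
Proof.
split; first by exists (rnorm (f 0)); exists 0 => //=; rewrite rnorm0.
have [_ [M fM]] := boundedOpP f; exists `|M| => _ [x /= x1 <-].
rewrite (le_trans (fM x))// (@le_trans _ _ (`|M| * rnorm x))//.
  by rewrite ler_wpM2r ?rnorm_ge0 ?ler_norm.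
by rewrite -[leRHS]mulr1 ler_wpM2l.
Qed.

Lemma opnorm_ge (f : boundedOp) x : rnorm x <= 1 -> rnorm (f x) <= opnorm f.
Proof.
by move=> x1; apply: (sup_upper_bound (opnorm_has_sup f)); exists x.
Qed.

Lemma opnorm_le (f : boundedOp) (M : R) :
  (forall x, rnorm x <= 1 -> rnorm (f x) <= M) -> opnorm f <= M.
Proof.
move=> fM; apply: ge_sup; first by have [] := opnorm_has_sup f.
by move=> _ [x x1 <-]; exact: fM.
Qed.

Lemma opnorm_ge0 (f : boundedOp) : 0 <= opnorm f.
Proof.
by apply: (le_trans (rnorm_ge0 (f 0))); apply: opnorm_ge; rewrite rnorm0.
Qed.

Lemma opnormP (f : boundedOp) x : rnorm (f x) <= opnorm f * rnorm x.
Proof.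
have [x0|x0] := eqVneq (rnorm x) 0.
  by rewrite (rnorm0_eq0 x0) boundedOp0E !rnorm0 mulr0.
have xgt0 : 0 < rnorm x by rewrite lt_def x0 rnorm_ge0.
have := @opnorm_ge f (scalar_of_real k (rnorm x)^-1 *: x).
rewrite boundedOp_scalable !rnormZr normfV ger0_norm ?rnorm_ge0// mulVf//.
by move=> /(_ (lexx _)); rewrite mulrC ler_pdivrMr.
Qed.

Lemma opnormD (f g : boundedOp) : opnorm (f + g) <= opnorm f + opnorm g.
Proof.
apply: opnorm_le => x x1 /=; rewrite (le_trans (rnormD _ _))//.
by rewrite lerD// opnorm_ge.
Qed.

Lemma opnormZ (a : R) (f : boundedOp) : opnorm (a *: f) = `|a| * opnorm f.
Proof.
have leZ b (g : boundedOp) : opnorm (b *: g) <= `|b| * opnorm g.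
  by apply: opnorm_le => x x1 /=; rewrite rnormZr ler_wpM2l// opnorm_ge.
apply/eqP; rewrite eq_le leZ /=.
have [->|a0] := eqVneq a 0; first by rewrite normr0 mul0r opnorm_ge0.
rewrite mulrC -ler_pdivlMr ?normr_gt0// mulrC -normfV.
by rewrite -{1}[f](scale1r) -(mulVf a0) -scalerA leZ.
Qed.

Lemma opnorm0_eq0 (f : boundedOp) : opnorm f = 0 -> f = 0.
Proof.
move=> f0; apply: boundedOp_ext => x /=; apply: rnorm0_eq0; apply/eqP.
by rewrite eq_le rnorm_ge0 andbT (le_trans (opnormP f x))// f0 mul0r.
Qed.

HB.instance Definition _ := Lmodule_isNormed.Build R boundedOp
  opnormD opnormZ opnorm0_eq0.

Lemma boundedOp_normE (f : boundedOp) : `|f| = opnorm f.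
Proof. by []. Qed.

Definition compact_op (f : E -> F) : Prop :=
  precompact (f @` [set x | `|x| <= 1]).

End bounded_operators.

(* the product is linear in its first argument; existence of the adjoint is the
   Riesz representation theorem *)
Definition adjoint (R : realType) (k : scalar_kind) (E F : hilbertType R k)
    (T : boundedOp E F) : boundedOp F E :=
  get [set S : boundedOp F E | forall x y, inner (T x) y = inner x (S y)].

Section eigenspaces.
Context {K : numFieldType} {E : lmodType K}.

Definition ker_sub (T : E -> E) (l : K) : set E := [set x | T x = l *: x].

Definition is_eigenvalue (T : E -> E) (l : K) : Prop :=
  exists2 x, x != 0 & ker_sub T l x.

(* l is the j-th largest (j >= 1) of the distinct eigenvalues of T; the
   eigenvalues are assumed to be real, so that the partial order of K is total
   on them *)
Definition is_nth_eigenvalue (T : E -> E) (j : nat) (l : K) : Prop :=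
  [/\ (0 < j)%N, is_eigenvalue T l &
      ([set l' | is_eigenvalue T l' /\ l < l'] #= `I_(j.-1))%card].

Definition eigenspace_sum (T : E -> E) (l : nat -> K) (r : nat) : set E :=
  [set x | exists2 u : nat -> E,
     (forall j, (0 < j <= r)%N -> ker_sub T (l j) (u j)) &
     x = \sum_(1 <= j < r.+1) u j].

Definition span (N : nat) (b : 'I_N -> E) : set E :=
  [set x | exists c : 'I_N -> K, x = \sum_i c i *: b i].

Definition lin_indep (N : nat) (b : 'I_N -> E) : Prop :=
  forall c : 'I_N -> K, \sum_i c i *: b i = 0 -> forall i, c i = 0.

Definition is_subspace_of_dim (V : set E) (N : nat) : Prop :=
  exists2 b : 'I_N -> E, lin_indep b & V = span b.

End eigenspaces.

Definition first_singular_space (R : realType) (k : scalar_kind)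
    (E F : hilbertType R k) (T : boundedOp E F) (N : nat) (V : set E) : Prop :=
  let TT := adjoint T \o T in
  is_subspace_of_dim V N /\
  ((exists2 l, is_nth_eigenvalue TT 1%N l & V `<=` ker_sub TT l) \/
   (exists (r : nat) (l : nat -> scalar R k),
      [/\ (0 < r)%N,
          forall j, (0 < j <= r)%N -> is_nth_eigenvalue TT j (l j),
          eigenspace_sum TT l r.-1 `<=` V &
          V `<=` eigenspace_sum TT l r])).

Definition euclid_norm (R : realType) (p : nat) (v : 'rV[R]_p) : R :=
  Num.sqrt (\sum_i v ord0 i ^+ 2).

(* for f : 'rV[R]_p -> boundedOp E F both clauses refer to the operator norm; as
   'rV[R]_p is finite dimensional, its sup norm gives the same notion as
   euclid_norm, and continuity of every 'D_q f is continuity of 'd f *)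
Definition C1_on (R : realType) (p : nat) (V : normedModType R)
    (D : set 'rV[R]_p) (f : 'rV[R]_p -> V) : Prop :=
  (forall x, D x -> differentiable f x) /\
  (forall q x, D x -> {for x, continuous ('D_q f)}).

(* Main.v *)
(** Write A = A_m, A' = A_{m'} for the operators and X_t(A) for the span of the
    eigenvectors of A^*A with eigenvalue at least t.

    By min-max and the compactness of B there is c > 0 with
    E_{m,N} ⊆ X_{c^2}(A_m) for all m in B.  If phi is in X_{c^2}(A) and psi in
    X_{c^2}(A'), decompose phi - psi = x + z along X_{c^2/4}(A).  Since psi is
    A'^*A' beta with |beta| <= c^-2 |psi|, iterating this shows that z is small:
    |z| = O(|A - A'| |psi|); and |x| is controlled by |A x|.  Hence
      |phi - psi| = O(|A (phi - psi)| + |A - A'| |psi|).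

    If no C > 0 worked, there would be a_n, b_n in B and phi_n, psi_n in these
    spaces with |phi_n| + |psi_n| = 1 and
    |A_{a_n} phi_n - A_{b_n} psi_n| = o(tau_n), where
    tau_n = |psi_n| |a_n - b_n| + |phi_n - psi_n|.  By compactness all of them
    converge along an ultrafilter, and condition (1) makes the limits agree: a_n
    and b_n tend to a, phi_n and psi_n to phi != 0.  Dividing by tau_n, with
    (a_n - b_n) / tau_n -> q, strict differentiability gives
    A_a x_n -> - d_q A_a phi for the bounded sequence x_n = (phi_n - psi_n) / tau_n,
    so d_q A_a phi is in the range of A_a (balls are weakly compact), and
    condition (2) forces q = 0.  The estimate above then gives x_n -> 0, which
    contradicts |psi_n| |a_n - b_n| / tau_n + |x_n| = 1. *)

From HB Require Import structures.
From mathcomp Require Import all_boot all_order all_algebra.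
From mathcomp Require Import sesquilinear complex.
From mathcomp Require Import boolp classical_sets functions cardinality reals.
From mathcomp Require Import topology normedtype derive sequences.
From mathcomp Require Import zify ring lra.
Require Import Defs.

Set Implicit Arguments.
Unset Strict Implicit.
Unset Printing Implicit Defensive.

Import Order.TTheory GRing.Theory Num.Theory.
Import numFieldNormedType.Exports.

Local Open Scope classical_set_scope.
Local Open Scope ring_scope.

Local Notation "a %:K" := (@scalar_of_real _ _ a) (at level 2, format "a %:K").
Local Notation re := (@scalar_re _ _).

Section scalar_re_theory.
Context {R : realType} {k : scalar_kind}.
Implicit Types (a : R) (z w : scalar R k).

Lemma scalar_reD z w : re (z + w) = re z + re w.
Proof. by case: k z w => //= -[a b] [c d]. Qed.

Lemma scalar_re0 : re (0 : scalar R k) = 0.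
Proof. by case: k. Qed.

Lemma scalar_reZ a z : re (a%:K * z) = a * re z.
Proof. by case: k z => //= -[b c] /=; rewrite mul0r subr0. Qed.

Lemma scalar_reJ z : re (scalar_conj z) = re z.
Proof. by case: k z => //= -[a b]. Qed.

Lemma scalar_conjr a : scalar_conj (a%:K : scalar R k) = a%:K.
Proof. by case: k => //=; rewrite oppr0. Qed.

Lemma scalar_conjK : involutive (@scalar_conj R k).
Proof. by case: k => //= -[a b]; rewrite /= opprK. Qed.

Lemma scalar_re_conjM_eq0 z : re (scalar_conj z * z) = 0 -> z = 0.
Proof.
case: k z => /= [z /eqP|[a b] /=]; first by rewrite mulf_eq0 orbb => /eqP.
rewrite mulNr opprK => /eqP; rewrite paddr_eq0 ?sqr_ge0 -?expr2 ?sqr_ge0//.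
by rewrite !sqrf_eq0 => /andP[/eqP -> /eqP ->].
Qed.

End scalar_re_theory.

Definition rin {R : realType} {k : scalar_kind} {E : hilbertType R k}
  (x y : E) : R := re (inner x y).

Section real_inner_product.
Context {R : realType} {k : scalar_kind} {E : hilbertType R k}.
Implicit Types (x y z : E) (a : R).

Lemma rinDl x y z : rin (x + y) z = rin x z + rin y z.
Proof. by rewrite /rin linearDl scalar_reD. Qed.

Lemma rinC x y : rin x y = rin y x.
Proof. by rewrite /rin [inner x y]hermitian_subproof expr0 mul1r scalar_reJ. Qed.

Lemma rinDr x y z : rin z (x + y) = rin z x + rin z y.
Proof. by rewrite rinC rinDl !(rinC z). Qed.

Lemma rinZl a x y : rin (a%:K *: x) y = a * rin x y.
Proof. by rewrite /rin linearZl_LR /= scalar_reZ. Qed.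

Lemma rinZr a x y : rin y (a%:K *: x) = a * rin y x.
Proof. by rewrite rinC rinZl rinC. Qed.

Lemma rin0l x : rin 0 x = 0.
Proof. by rewrite /rin linear0l scalar_re0. Qed.

Lemma rin0r x : rin x 0 = 0.
Proof. by rewrite rinC rin0l. Qed.

Lemma rinNl x y : rin (- x) y = - rin x y.
Proof. by apply/eqP; rewrite -addr_eq0 -rinDl addNr rin0l. Qed.

Lemma rinNr x y : rin y (- x) = - rin y x.
Proof. by rewrite rinC rinNl rinC. Qed.

Lemma rinBl x y z : rin (x - y) z = rin x z - rin y z.
Proof. by rewrite rinDl rinNl. Qed.

Lemma rinBr x y z : rin z (x - y) = rin z x - rin z y.
Proof. by rewrite rinDr rinNr. Qed.

Lemma rin_suml I (r : seq I) (P : pred I) (F : I -> E) y :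
  rin (\sum_(i <- r | P i) F i) y = \sum_(i <- r | P i) rin (F i) y.
Proof.
by apply: (big_morph (fun x => rin x y)) => [u v|]; rewrite ?rinDl ?rin0l.
Qed.

Lemma rin_sumr I (r : seq I) (P : pred I) (F : I -> E) y :
  rin y (\sum_(i <- r | P i) F i) = \sum_(i <- r | P i) rin y (F i).
Proof. by rewrite rinC rin_suml; apply: eq_bigr => i _; rewrite rinC. Qed.

Lemma rinxx x : rin x x = rnorm x ^+ 2.
Proof.
rewrite /rin -inner_norm -rnormE expr2 scalar_reZ.
by rewrite scalar_of_realK expr2.
Qed.

Lemma rnormD_sqr x y :
  rnorm (x + y) ^+ 2 = rnorm x ^+ 2 + 2 * rin x y + rnorm y ^+ 2.
Proof. by rewrite -!rinxx rinDl !rinDr (rinC y x); ring. Qed.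

Lemma rnormB_sqr x y :
  rnorm (x - y) ^+ 2 = rnorm x ^+ 2 - 2 * rin x y + rnorm y ^+ 2.
Proof. by rewrite rnormD_sqr rinNr rnormN mulrN. Qed.

Lemma rnorm_gt0 x : (0 < rnorm x) = (x != 0).
Proof.
rewrite lt_def rnorm_ge0 andbT; congr negb.
by apply/eqP/eqP => [/rnorm0_eq0 //|->]; rewrite rnorm0.
Qed.

Lemma ler_rnorm_sqr x (b : R) : 0 <= b -> (rnorm x <= b) = (rnorm x ^+ 2 <= b ^+ 2).
Proof. by move=> b0; rewrite ler_sqr// nnegrE ?rnorm_ge0. Qed.

Lemma ler_rin x y : rin x y <= rnorm x * rnorm y.
Proof.
have [->|x0] := eqVneq x 0; first by rewrite rin0l rnorm0 mul0r.
have [->|y0] := eqVneq y 0; first by rewrite rin0r rnorm0 mulr0.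
have X : 0 < rnorm x by rewrite rnorm_gt0.
have Y : 0 < rnorm y by rewrite rnorm_gt0.
have := sqr_ge0 (rnorm ((rnorm y)%:K *: x - (rnorm x)%:K *: y)).
rewrite rnormB_sqr !rnormZr rinZl rinZr !ger0_norm ?rnorm_ge0//.
by have XY := mulr_gt0 X Y; rewrite -[_ <= _ * _](ler_pM2l XY) => H; nra.
Qed.

Lemma ler_norm_rin x y : `|rin x y| <= rnorm x * rnorm y.
Proof.
by rewrite ler_norml ler_rin andbT lerNl -rinNl (le_trans (ler_rin _ _))// rnormN.
Qed.

Lemma rin_ext x y : (forall z, rin x z = rin y z) -> x = y.
Proof.
move=> xy; apply/eqP; rewrite -subr_eq0; apply/eqP/rnorm0_eq0/eqP.
by rewrite -sqrf_eq0 -rinxx rinBl xy subrr.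
Qed.

Lemma rin_Kconj (c : scalar R k) x y :
  rin (c *: x) y = rin x (scalar_conj c *: y).
Proof.
by rewrite /rin linearZl_LR linearZr_LR /= scalar_conjK.
Qed.

Lemma rnormBC x y : rnorm (x - y) = rnorm (y - x).
Proof. by rewrite -opprB rnormN. Qed.

Lemma parallelogram x y :
  rnorm (x - y) ^+ 2 = 2 * rnorm x ^+ 2 + 2 * rnorm y ^+ 2
    - 4 * rnorm (2^-1%:K *: (x + y)) ^+ 2.
Proof.
rewrite rnormZr exprMn rnormB_sqr rnormD_sqr ger0_norm ?invr_ge0//.
move: (rnorm x) (rnorm y) (rin x y) => a b c.
have -> : 2^-1 ^+ 2 = 4^-1 :> R by rewrite exprVn -natrX.
lra.
Qed.

End real_inner_product.

Lemma cvg0_le {R : realType} {I : Type} (U : set_system I) {UF : Filter U}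
  (f g : I -> R) :
  g @ U --> (0 : R) -> (\forall n \near U, 0 <= f n <= g n) -> f @ U --> (0 : R).
Proof.
move=> /cvgr0Pnorm_lt g0 fg; apply/cvgr0Pnorm_lt => e e0.
move: fg (g0 e e0); apply: filterS2 => n /andP[f0 fg].
move=> h; rewrite ger0_norm//; apply: le_lt_trans h.
exact: le_trans (ler_norm _).
Qed.

Lemma cvg0_leW {R : realType} {I : Type} (U : set_system I) {UF : Filter U}
  (f g : I -> R) :
  g @ U --> (0 : R) -> (forall n, 0 <= f n <= g n) -> f @ U --> (0 : R).
Proof. by move=> g0 fg; refine (cvg0_le g0 _); apply: nearW. Qed.

Lemma cvg_le {R : realType} {I : Type} (U : set_system I) {UF : ProperFilter U}
  (f g : I -> R) (l m : R) :
  f @ U --> l -> g @ U --> m -> (\forall n \near U, f n <= g n) -> l <= m.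
Proof.
move=> fl gm fg; rewrite leNgt; apply/negP => ml.
have fz : \forall n \near U, (l + m) / 2 < f n by apply: (cvgr_gt _ fl); lra.
have gz : \forall n \near U, g n < (l + m) / 2 by apply: (cvgr_lt _ gm); lra.
have : U set0.
  move: fg fz gz; apply: filterS3 => n /= a b c.
  by have := lt_trans b (le_lt_trans a c); rewrite ltxx.
by move=> /filter_ex[].
Qed.

Definition rcvg {R : realType} {k : scalar_kind} {E : normedModType (scalar R k)}
  {I : Type} (U : set_system I) (x : I -> E) (l : E) :=
  (fun n => rnorm (x n - l)) @ U --> (0 : R).

Section rcvg_theory.
Context {R : realType} {k : scalar_kind} {I : Type} (U : set_system I).
Context {UF : ProperFilter U}.

Section normed.
Context {E : normedModType (scalar R k)}.
Implicit Types (x y : I -> E) (l m : E).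

Lemma rcvgP x l :
  rcvg U x l <-> forall e : R, 0 < e -> \forall n \near U, rnorm (x n - l) < e.
Proof.
split=> [/cvgr0Pnorm_lt xl e e0|xl].
  apply: filterS (xl e e0) => n.
  by rewrite ger0_norm// rnorm_ge0.
apply/cvgr0Pnorm_lt => e e0; apply: filterS (xl e e0) => n.
by rewrite ger0_norm// rnorm_ge0.
Qed.

Lemma rcvg_cst l : rcvg U (fun=> l) l.
Proof. by rewrite /rcvg subrr rnorm0; exact: cvg_cst. Qed.

Lemma rcvgD x y l m : rcvg U x l -> rcvg U y m -> rcvg U (fun n => x n + y n) (l + m).
Proof.
move=> xl ym; 
have h : (fun n => rnorm (x n - l) + rnorm (y n - m)) @ U --> (0 : R).
  by rewrite -[X in _ --> X]addr0; exact: cvgD xl ym.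
refine (cvg0_leW h _) => n; rewrite rnorm_ge0 opprD addrACA; apply: rnormD.
Qed.

Lemma rcvgN x l : rcvg U x l -> rcvg U (fun n => - x n) (- l).
Proof. by move=> xl; refine (cvg0_leW xl _) => n; rewrite rnorm_ge0 -opprD rnormN lexx. Qed.

Lemma rcvgB x y l m : rcvg U x l -> rcvg U y m -> rcvg U (fun n => x n - y n) (l - m).
Proof. by move=> xl /rcvgN; exact: rcvgD. Qed.

Lemma ler_rnorm_dist (u v : E) : `|rnorm u - rnorm v| <= rnorm (u - v).
Proof.
rewrite ler_norml lerBrDr lerBlDr addrC lerBlDr.
have := rnormD (u - v) v; have := rnormD u (v - u).
by rewrite subrK addrCA subrr addr0 -(opprB u v) rnormN => -> ->.
Qed.

Lemma rcvg_rnorm x l : rcvg U x l -> (fun n => rnorm (x n)) @ U --> rnorm l.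
Proof.
move=> xl; apply/subr_cvg0/norm_cvg0P; refine (cvg0_leW xl _) => n.
by rewrite normr_ge0 ler_rnorm_dist.
Qed.

Lemma rcvg_unique x l m : rcvg U x l -> rcvg U x m -> l = m.
Proof.
move=> xl xm; apply/eqP; rewrite -subr_eq0; apply/eqP/rnorm0_eq0.
have := rcvg_rnorm (rcvgB xl xm); rewrite (_ : (fun n => _) = fun=> 0).
  by move=> h; rewrite -(cvg_lim _ h) ?lim_cst.
by apply/funext => n; rewrite subrr rnorm0.
Qed.

Lemma rcvgZr (a : I -> R) (b : R) x l : a @ U --> b -> rcvg U x l ->
  rcvg U (fun n => (a n)%:K *: x n) (b%:K *: l).
Proof.
move=> ab xl.
have h : (fun n => `|a n| * rnorm (x n - l) + `|a n - b| * rnorm l) @ U --> (0 : R).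
  rewrite -[X in _ --> X]addr0 -[X in _ --> X + _](mulr0 `|b|).
  rewrite -[X in _ --> _ + X](mul0r (rnorm l)); apply: cvgD.
    by apply: cvgM => //; exact: cvg_norm.
  apply: cvgM; last exact: cvg_cst.
  by apply/norm_cvg0P/subr_cvg0.
refine (cvg0_leW h _) => n; rewrite rnorm_ge0 /=.
have -> : (a n)%:K *: x n - b%:K *: l = (a n)%:K *: (x n - l) + (a n - b)%:K *: l.
  rewrite scalerBr scalar_of_realD scalerDl.
  rewrite (_ : (- b)%:K = - b%:K); first by rewrite scaleNr addrA subrK.
  by apply/eqP; rewrite -addr_eq0 -scalar_of_realD addNr scalar_of_real0.
by rewrite (le_trans (rnormD _ _))// !rnormZr.
Qed.

Lemma rcvg_cvg x l : x @ U --> l -> rcvg U x l.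
Proof.
move=> /cvgrPdist_lt xl; apply/rcvgP => e e0.
have eK : 0 < (e%:K : scalar R k).
  rewrite lt_def -{2}(@scalar_of_real0 R k) ler_scalar_of_real (ltW e0) andbT.
  apply/eqP => h; move: e0; rewrite -(@scalar_of_realK R k e) h.
  by rewrite scalar_re0 ltxx.
apply: filterS (xl _ eK) => n.
rewrite distrC -rnormE !lt_def ler_scalar_of_real => /andP[/eqP en ->].
by rewrite andbT; apply/eqP => ee; apply: en; rewrite ee.
Qed.

End normed.

Section hilbert.
Context {E : hilbertType R k}.

Lemma rcvg_rin (x y : I -> E) (l m : E) : rcvg U x l -> rcvg U y m ->
  (fun n => rin (x n) (y n)) @ U --> rin l m.
Proof.
move=> xl ym; apply/subr_cvg0/norm_cvg0P.
have h : (fun n => rnorm (x n - l) * rnorm (y n) + rnorm l * rnorm (y n - m)) @ U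
    --> (0 : R).
  rewrite -[X in _ --> X]addr0 -[X in _ --> X + _](mul0r (rnorm m)).
  rewrite -[X in _ --> _ + X](mulr0 (rnorm l)).
  apply: cvgD; apply: cvgM => //; first exact: rcvg_rnorm.
  exact: cvg_cst.
refine (cvg0_leW h _) => n; rewrite normr_ge0 /=.
have -> : rin (x n) (y n) - rin l m = rin (x n - l) (y n) + rin l (y n - m).
  by rewrite rinBl rinBr; ring.
by rewrite (le_trans (ler_normD _ _))// lerD// ler_norm_rin.
Qed.

End hilbert.

Section operators.
Context {E F : normedModType (scalar R k)}.

Lemma boundedOpD1 (T : boundedOp E F) x y : T (x + y) = T x + T y.
Proof. by have := boundedOp_linear T 1 x y; rewrite !scale1r. Qed.

Lemma boundedOpN1 (T : boundedOp E F) x : T (- x) = - T x.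
Proof. by rewrite -scaleN1r boundedOp_scalable scaleN1r. Qed.

Lemma boundedOpB1 (T : boundedOp E F) x y : T (x - y) = T x - T y.
Proof. by rewrite boundedOpD1 boundedOpN1. Qed.

Lemma rcvg_op (T : I -> boundedOp E F) (T0 : boundedOp E F) x l :
  opnorm (T n - T0) @[n --> U] --> (0 : R) -> rcvg U x l ->
  rcvg U (fun n => T n (x n)) (T0 l).
Proof.
move=> TT xl; have h : (fun n => opnorm (T n - T0) * rnorm (x n) +
    opnorm T0 * rnorm (x n - l)) @ U --> (0 : R).
  rewrite -[X in _ --> X]addr0 -[X in _ --> X + _](mul0r (rnorm l)).
  rewrite -[X in _ --> _ + X](mulr0 (opnorm T0)).
  apply: cvgD; apply: cvgM => //; first exact: rcvg_rnorm.
  exact: cvg_cst.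
refine (cvg0_leW h _) => n; rewrite rnorm_ge0 /=.
have -> : T n (x n) - T0 l = (T n - T0) (x n) + T0 (x n - l).
  by rewrite boundedOpB1 /= addrA subrK.
by rewrite (le_trans (rnormD _ _))// lerD// opnormP.
Qed.

Lemma rcvg_op_cst (T : boundedOp E F) x l :
  rcvg U x l -> rcvg U (fun n => T (x n)) (T l).
Proof.
apply: (@rcvg_op (fun=> T)); rewrite subrr -boundedOp_normE normr0.
exact: cvg_cst.
Qed.

End operators.
End rcvg_theory.

Lemma ultra_fmap {I J : Type} (U : set_system I) (UU : UltraFilter U) (f : I -> J) :
  UltraFilter (f @ U).
Proof.
split=> [|G GF UG]; first exact: fmap_proper_filter.
rewrite predeqE => A; split=> [GA|/UG//].
have [//|UA] := in_ultra_setVsetC (f @^-1` A) UU.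
have /filterI/(_ GA) : G (~` A) by apply: UG.
by rewrite setICl => /filter_ex[].
Qed.

Lemma compact_op_ultra {R : realType} {k : scalar_kind}
  {E F : normedModType (scalar R k)} {I : Type} (U : set_system I)
  (UU : UltraFilter U) (T : boundedOp E F) (x : I -> E) (M : R) :
  compact_op T -> (forall n, rnorm (x n) <= M) ->
  exists g, rcvg U (fun n => T (x n)) g.
Proof.
move=> cT xM; have M1 : 0 < `|M| + 1 by rewrite ltr_pwDr.
pose y n := (`|M| + 1)^-1%:K *: x n.
have y1 n : `|y n| <= 1.
  rewrite -rnormE -(@scalar_of_real1 R k) ler_scalar_of_real rnormZr.
  rewrite ger0_norm ?invr_ge0 ?(ltW M1)// mulrC ler_pdivrMr// mul1r.
  by rewrite (le_trans (xM n))// (le_trans (ler_norm _))// lerDl.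
move: cT; rewrite /compact_op precompactE compact_ultra.
have UG := ultra_fmap UU (fun n => T (y n)).
move=> /(_ _ UG)[].
  apply: nearW => n; apply: subset_closure; by exists (y n) => //=.
move=> g [_ /= Tg]; exists ((`|M| + 1)%:K *: g).
have -> : (fun n => T (x n)) = (fun n => (`|M| + 1)%:K *: T (y n)).
  apply/funext => n; rewrite boundedOp_scalable scalerA -scalar_of_realM.
  by rewrite mulfV ?gt_eqF// scalar_of_real1 scale1r.
by apply: rcvgZr; [exact: cvg_cst|exact: rcvg_cvg].
Qed.

Section completeness.
Context {R : realType} {k : scalar_kind}.

Lemma rcvg_complete {E : completeNormedModType (scalar R k)} (x : nat -> E) :
  (forall e : R, 0 < e -> exists n0 : nat, forall n m : nat,
     (n0 <= n)%N -> (n0 <= m)%N -> rnorm (x n - x m) < e) ->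
  exists l, rcvg \oo x l.
Proof.
move=> xC; have cx : cvg (x @ \oo).
  apply/cauchy_cvgP/cauchy_ballP => e e0.
  have re0 : 0 < re e.
    rewrite lt_def -(@ler_scalar_of_real R k) scalar_of_real0 scalar_reK ?(ltW e0)//.
    rewrite andbT; apply/eqP => h; have := scalar_reK (ltW e0); rewrite h scalar_of_real0 => e00.
    by rewrite -e00 ltxx in e0.
  have [n0 n0P] := xC _ re0.
  exists ([set y | exists2 n, (n0 <= n)%N & y = x n],
          [set y | exists2 n, (n0 <= n)%N & y = x n]) => /=.
    by split; (exists n0 => // n /= nn; exists n).
  move=> [a b] [/= [n nn ->] [m mm ->]]; rewrite -ball_normE /=.
  rewrite -rnormE -(@scalar_reK R k e) ?(ltW e0)// lt_def ler_scalar_of_real.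
  have h := n0P n m nn mm; rewrite (ltW h) andbT.
  apply/eqP => /(congr1 (@scalar_re R k)); rewrite !scalar_of_realK => eh.
  by move: h; rewrite eh ltxx.
by exists (lim (x @ \oo)); exact: rcvg_cvg.
Qed.

End completeness.

Section hilbert.
Context {R : realType} {k : scalar_kind} {E : hilbertType R k}.
Implicit Types x y z : E.

Lemma nested_convex_cvg (C : nat -> set E) (M : R) :
  (forall n, C n.+1 `<=` C n) ->
  (forall n x y, C n x -> C n y -> C n (2^-1%:K *: (x + y))) ->
  (forall n, exists2 x, C n x & rnorm x <= M) ->
  exists (x : nat -> E) l, [/\ forall n, C n (x n), rcvg \oo x l &
    forall y, (forall n, C n y) -> rnorm l <= rnorm y].
Proof.
move=> Cdec Cconv Cne.
have Csub n m : (n <= m)%N -> C m `<=` C n.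
  move=> /subnK <-; elim: (m - n)%N => // i IH x; rewrite addSn => /Cdec; exact: IH.
pose d n := inf [set rnorm x | x in C n].
have Chi n : has_inf [set rnorm x | x in C n].
  split; first by have [x Cx _] := Cne n; exists (rnorm x); exists x.
  by exists 0 => _ [x _ <-]; exact: rnorm_ge0.
have dle n x : C n x -> d n <= rnorm x.
  by move=> Cx; apply: ge_inf; [exact: (Chi n).2|exists x].
have d_ge0 n : 0 <= d n.
  by apply: lb_le_inf; [exact: (Chi n).1|move=> _ [x _ <-]; exact: rnorm_ge0].
have dM n : d n <= M by have [x /dle dx xM] := Cne n; exact: le_trans dx xM.
have dmono n m : (n <= m)%N -> d n <= d m.
  move=> nm; apply: lb_le_inf; first exact: (Chi m).1.
  by move=> _ [x Cx <-]; apply: dle; exact: Csub nm _ Cx.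
have xex n : exists x, C n x /\ rnorm x <= d n + n.+1%:R^-1.
  have e0 : 0 < n.+1%:R^-1 :> R by rewrite invr_gt0.
  have [_ [x Cx <-] xd] := inf_adherent e0 (Chi n).
  by exists x; split => //; exact: ltW.
have [x xP] := choice xex.
have Dsup : has_sup (range d).
  by split; [exists (d 0); exists 0%N|exists M => _ [n _ <-]].
set D := sup (range d).
have dD n : d n <= D by apply: sup_upper_bound => //; exists n.
have D0 : 0 <= D by exact: le_trans (d_ge0 0%N) (dD 0%N).
have key (eta : R) (n m : nat) : 0 < eta -> D - eta <= d n -> D - eta <= d m ->
    n.+1%:R^-1 <= eta -> m.+1%:R^-1 <= eta ->
    rnorm (x n - x m) ^+ 2 <= 16 * (D + eta) * eta.
  wlog nm : n m / (n <= m)%N => [hw|].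
    have [nm|/ltnW mn] := leqP n m; first exact: hw.
    by move=> *; rewrite rnormBC; apply: hw.
  move=> eta0 dn dm ne me; rewrite parallelogram.
  have [Cn xn] := xP n; have [/(Csub _ _ nm) Cm xm] := xP m.
  have mid := dle _ _ (Cconv _ _ _ Cn Cm).
  have x1 : rnorm (x n) <= D + eta by rewrite (le_trans xn)// lerD.
  have x2 : rnorm (x m) <= D + eta by rewrite (le_trans xm)// lerD.
  have := rnorm_ge0 (x n); have := rnorm_ge0 (x m); have := d_ge0 n.
  move: mid dn x1 x2; move: (rnorm _) (rnorm (x n)) (rnorm (x m)) (d n).
  move=> a b c dd h1 h2 h3 h4 dd0 c0 b0.
  have b2 : b ^+ 2 <= (D + eta) ^+ 2 by rewrite ler_pXn2r// nnegrE (le_trans b0).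
  have c2 : c ^+ 2 <= (D + eta) ^+ 2 by rewrite ler_pXn2r// nnegrE (le_trans c0).
  have a2 : dd ^+ 2 <= a ^+ 2 by rewrite ler_pXn2r// nnegrE (le_trans dd0).
  have [Deta|Deta] := leP D eta.
    have : 0 <= dd ^+ 2 by exact: sqr_ge0.
    by nra.
  have : (D - eta) ^+ 2 <= dd ^+ 2 by rewrite ler_pXn2r// nnegrE subr_ge0 ltW.
  by nra.
have xC : forall e : R, 0 < e -> exists n0 : nat, forall n m : nat,
    (n0 <= n)%N -> (n0 <= m)%N -> rnorm (x n - x m) < e.
  move=> e e0.
  have [eta [eta0 etaP]] : exists eta : R, 0 < eta /\ 16 * (D + eta) * eta < e ^+ 2.
    exists (Num.min 1 (e ^+ 2 / (32 * (D + 1)))).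
    have D1 : 0 < D + 1 by rewrite ltr_pwDr.
    have p0 : 0 < e ^+ 2 / (32 * (D + 1)) by rewrite divr_gt0 ?exprn_gt0 ?mulr_gt0.
    split; first by rewrite lt_min ltr01.
    set eta := Num.min _ _.
    have eta1 : eta <= 1 by rewrite ge_min lexx.
    have eta0 : 0 < eta by rewrite lt_min ltr01.
    have eta2 : eta * (32 * (D + 1)) <= e ^+ 2.
      by rewrite -ler_pdivlMr ?mulr_gt0// ge_min lexx orbT.
    have e2 : 0 < e ^+ 2 by rewrite exprn_gt0.
    by nra.
  have [_ [n1 _ <-] n1P] := sup_adherent eta0 Dsup.
  have [n2 n2P] := ltr_add_invr (ltr_pwDr eta0 (lexx 0)).
  exists (maxn n1 n2) => n m; rewrite !geq_max => /andP[n1n n2n] /andP[n1m n2m].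
  rewrite -(@ltr_pXn2r _ 2)// ?nnegrE ?rnorm_ge0 ?(ltW e0)//.
  apply: le_lt_trans etaP; apply: key => //.
  - by rewrite (le_trans (ltW n1P))// dmono.
  - by rewrite (le_trans (ltW n1P))// dmono.
  - have h : 0 + n2.+1%:R^-1 < eta by move: n2P; rewrite !add0r.
    rewrite add0r in h; rewrite (le_trans _ (ltW h))//.
    by rewrite lef_pV2 ?posrE// ler_nat.
  - have h : 0 + n2.+1%:R^-1 < eta by move: n2P; rewrite !add0r.
    rewrite add0r in h; rewrite (le_trans _ (ltW h))//.
    by rewrite lef_pV2 ?posrE// ler_nat.
have [l xl] := rcvg_complete xC.
exists x, l; split => // [n|y yC]; first by have [] := xP n.
have h : (fun n => rnorm y + n.+1%:R^-1) @ \oo --> rnorm y.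
  rewrite -[X in _ --> X]addr0; apply: cvgD; first exact: cvg_cst.
  exact: cvg_harmonic.
refine (cvg_le (rcvg_rnorm xl) h _); apply: nearW => n.
by have [_ /le_trans] := xP n; apply; rewrite lerD2r dle.
Qed.

End hilbert.

Lemma scaler_half_double {R : realType} {k : scalar_kind}
  {E : lmodType (scalar R k)} (x : E) : 2^-1%:K *: (x + x) = x.
Proof.
rewrite -{1 2}[x]scale1r -scalerDl -(@scalar_of_real1 R k) -scalar_of_realD.
rewrite scalerA -scalar_of_realM mulVf ?pnatr_eq0//.
by rewrite scalar_of_real1 scale1r.
Qed.

Section projection.
Context {R : realType} {k : scalar_kind} {E : hilbertType R k}.
Implicit Types x y z v : E.

Definition real_subspace (X : set E) :=
  [/\ X 0, forall x y, X x -> X y -> X (x + y) & forall (a : R) x, X x -> X (a%:K *: x)].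

Lemma real_subspaceN (X : set E) x : real_subspace X -> X x -> X (- x).
Proof.
move=> [_ _ XZ] /(XZ (- 1)); congr X; apply/eqP; rewrite -addr_eq0.
rewrite -{2}[x]scale1r -(@scalar_of_real1 R k) -scalerDl -scalar_of_realD.
by rewrite addNr scalar_of_real0 scale0r.
Qed.

Lemma rin_variational z v :
  (forall t : R, rnorm z <= rnorm (z + t%:K *: v)) -> rin z v = 0.
Proof.
move=> zv; apply/eqP; apply/negP => /negP zv0.
have v0 : 0 < rnorm v.
  by rewrite rnorm_gt0; apply: contraNneq zv0 => ->; rewrite rin0r.
set t := - rin z v / rnorm v ^+ 2.
have := zv t; rewrite ler_rnorm_sqr ?rnorm_ge0// rnormD_sqr rinZr rnormZr.
rewrite exprMn real_normK ?num_real// -addrA lerDl.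
have v2 : 0 < rnorm v ^+ 2 by rewrite exprn_gt0.
have tE : t * rnorm v ^+ 2 = - rin z v by rewrite /t divfK ?gt_eqF.
have r2 : 0 < rin z v ^+ 2 by rewrite exprn_even_gt0.
have -> : t ^+ 2 * rnorm v ^+ 2 = t * - rin z v by rewrite -tE; ring.
move=> h.
have : 0 <= (2 * (t * rin z v) + t * - rin z v) * rnorm v ^+ 2.
  by rewrite mulr_ge0// ltW.
have -> : (2 * (t * rin z v) + t * - rin z v) * rnorm v ^+ 2 =
   (t * rnorm v ^+ 2) * rin z v by ring.
by rewrite tE mulNr oppr_ge0 leNgt -expr2 r2.
Qed.

Lemma orthogonal_decomposition (X : set E) x : real_subspace X ->
  exists y z (u : nat -> E), [/\ x = y + z, forall n, X (u n), rcvg \oo u y &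
    forall v, X v -> rin z v = 0].
Proof.
move=> Xs; have [X0 XD XZ] := Xs.
pose C (n : nat) := [set w | exists2 u, X u & w = x - u].
have [||n|w [z [wC wz zmin]]] := @nested_convex_cvg _ _ _ C (rnorm x).
- by move=> n w.
- move=> n _ _ [u Xu ->] [v Xv ->].
  exists (2^-1%:K *: (u + v)); first by apply: XZ; exact: XD.
  rewrite addrACA -opprD scalerBr; congr (_ - _).
  exact: scaler_half_double.
- by exists x => //; exists 0 => //; rewrite subr0.
have uE n : exists u, X u /\ w n = x - u by have [u Xu ->] := wC n; exists u.
have [u uP] := choice uE.
exists (x - z), z, u; split => [|n||v Xv].
- by rewrite subrK.
- by have [] := uP n.
- have -> : u = (fun n => x - w n).
    by apply/funext => n; have [_ ->] := uP n; rewrite opprB addrC subrK.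
  by apply: rcvgB => //; exact: rcvg_cst.
apply: rin_variational => t.
have h : rcvg \oo (fun n => w n + t%:K *: v) (z + t%:K *: v).
  by apply: rcvgD => //; exact: rcvg_cst.
refine (cvg_le (cvg_cst (rnorm z)) (rcvg_rnorm h) _); apply: nearW => n.
apply: zmin => m; have [Xu ->] := uP n.
exists (u n - t%:K *: v); last by rewrite opprB addrA addrAC.
by apply: XD => //; apply: real_subspaceN => //; exact: XZ.
Qed.

Lemma riesz (f : E -> R) (M : R) :
  (forall x y, f (x + y) = f x + f y) -> (forall a x, f (a%:K *: x) = a * f x) ->
  (forall x, `|f x| <= M * rnorm x) -> exists y, forall x, f x = rin x y.
Proof.
move=> fD fZ fM.
have [f0|/existsNP[x fx]] := pselect (forall x, f x = 0).
  by exists 0 => x; rewrite f0 rin0r.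
have f00 : f 0 = 0 by have := fZ 0 0; rewrite mul0r scaler0.
have fN y : f (- y) = - f y by apply/eqP; rewrite -addr_eq0 -fD addNr f00.
have kerX : real_subspace [set y | f y = 0].
  by split => // [u v /= fu fv|a u /= fu]; rewrite ?fD ?fZ ?fu ?fv ?addr0 ?mulr0.
have [y [z [u [xyz uX uy zX]]]] := orthogonal_decomposition x kerX.
have fy : f y = 0.
  apply/eqP; rewrite -normr_le0.
  have h : (fun n => M * rnorm (u n - y)) @ \oo --> (0 : R).
    by rewrite -[X in _ --> X](mulr0 M); apply: cvgM => //; exact: cvg_cst.
  refine (cvg_le (cvg_cst _) h _); apply: nearW => n.
  by have := fM (u n - y); rewrite fD fN (uX n) add0r normrN.
have fz : f z != 0 by apply/eqP => fz; apply: fx; rewrite xyz fD fy fz addr0.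
have z0 : 0 < rnorm z by rewrite rnorm_gt0; apply: contraNneq fz => ->; rewrite f00.
exists ((f z / rnorm z ^+ 2)%:K *: z) => w.
have : rin z (w - (f w / f z)%:K *: z) = 0.
  by apply: zX => /=; rewrite fD fN fZ divfK// subrr.
rewrite rinBr rinZr rinxx => /eqP; rewrite subr_eq0 => /eqP wz.
rewrite rinZr rinC wz; have z2 : rnorm z != 0 by rewrite gt_eqF.
by field; rewrite fz.
Qed.

End projection.

Section adjoint_existence.
Context {R : realType} {k : scalar_kind} {E F : hilbertType R k}.
Implicit Types T : boundedOp E F.

Lemma adjoint_exists T :
  exists S : boundedOp F E, forall x y, inner (T x) y = inner x (S y).
Proof.
have Sex y : exists z, forall x, rin (T x) y = rin x z.
  apply: (@riesz _ _ _ (fun x => rin (T x) y) (opnorm T * rnorm y)).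
  - by move=> u v; rewrite boundedOpD1 rinDl.
  - by move=> a u; rewrite boundedOp_scalable rinZl.
  - move=> u; rewrite (le_trans (ler_norm_rin _ _))//.
    by rewrite mulrAC ler_wpM2r ?rnorm_ge0// opnormP.
have [S SP] := choice Sex.
have Slin : bounded_linear S.
  split=> [a x y|].
    apply: rin_ext => z; rewrite rinC -SP rinC rinDl rin_Kconj rinDl rin_Kconj.
    rewrite (rinC _ (T z)) (rinC (S x)) (rinC (S y)) -!SP -boundedOp_scalable.
    by rewrite !(rinC _ (T _)) SP.
  exists (opnorm T) => y; have [->|Sy] := eqVneq (S y) 0.
    by rewrite rnorm0 mulr_ge0 ?rnorm_ge0// opnorm_ge0.
  have Sy0 : 0 < rnorm (S y) by rewrite rnorm_gt0.
  rewrite -(ler_pM2l Sy0) -expr2 -rinxx -SP (le_trans (ler_rin _ _))//.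
  by rewrite mulrA (mulrC (rnorm (S y))) ler_wpM2r ?rnorm_ge0// opnormP.
exists (BoundedOp Slin) => x y /=.
apply/eqP; rewrite -subr_eq0; apply/eqP.
set c := inner (T x) y - inner x (S y).
have cE : forall d : scalar R k, re (d * c) = 0.
  move=> d; have := SP y (d *: x).
  rewrite boundedOp_scalable /rin !linearZl_LR /= => h.
  have -> : d * c = d * inner (T x) y + (- 1)%:K * (d * inner x (S y)).
    rewrite mulrBr; congr (_ + _); apply/eqP; rewrite eq_sym -subr_eq0 opprK.
    rewrite -{2}[d * inner x _]mul1r -(@scalar_of_real1 R k) -mulrDl.
    by rewrite -scalar_of_realD addNr scalar_of_real0 mul0r.
  by rewrite scalar_reD scalar_reZ h mulN1r subrr.
exact: scalar_re_conjM_eq0 (cE _).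
Qed.

Lemma inner_adjoint T x y : inner (T x) y = inner x (adjoint T y).
Proof. by have := getPex (adjoint_exists T); exact. Qed.

Lemma rin_adjoint T x y : rin (T x) y = rin x (adjoint T y).
Proof. by rewrite /rin inner_adjoint. Qed.

Lemma rin_adjointl T x y : rin (adjoint T y) x = rin y (T x).
Proof. by rewrite rinC -rin_adjoint rinC. Qed.

Lemma bounded_range_closed T {I : Type} (U : set_system I) {UF : ProperFilter U}
  (x : I -> E) (M : R) g : (forall n, rnorm (x n) <= M) ->
  rcvg U (fun n => T (x n)) g -> exists y, T y = g.
Proof.
move=> xM /rcvgP Txg.
pose C (n : nat) := [set y | rnorm (T y - g) <= n.+1%:R^-1].
have [n y|n y z|n|w [l [wC wl _]]] := @nested_convex_cvg _ _ _ C M.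
- by rewrite /C /= => /le_trans; apply; rewrite lef_pV2 ?posrE// ler_nat.
- rewrite /C /= => Cy Cz.
  have -> : T (2^-1%:K *: (y + z)) - g = 2^-1%:K *: ((T y - g) + (T z - g)).
    rewrite boundedOp_scalable boundedOpD1 (addrACA (T y)) -opprD scalerBr.
    by rewrite scaler_half_double.
  rewrite rnormZr ger0_norm ?invr_ge0// mulrC ler_pdivrMr// mulr2n mulrDr mulr1.
  by rewrite (le_trans (rnormD _ _))// lerD.
- have e0 : 0 < n.+1%:R^-1 :> R by rewrite invr_gt0.
  have /filter_ex[m xm] := Txg _ e0.
  by exists (x m) => //; exact: ltW.
exists l; refine (rcvg_unique (rcvg_op_cst T wl) _).
refine (cvg0_leW (@cvg_harmonic R) _) => n; rewrite rnorm_ge0 /=; exact: wC.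
Qed.

End adjoint_existence.

Lemma cvg_sub {R : realType} {I : Type} (U V : set_system I) (f : I -> R) (l : R) :
  U `<=` V -> f @ U --> l -> f @ V --> l.
Proof. by move=> UV fl A /fl; exact: UV. Qed.

Lemma cvg0_sqr {R : realType} {I : Type} (U : set_system I) {UF : Filter U}
  (f : I -> R) : (fun n => f n ^+ 2) @ U --> (0 : R) -> f @ U --> (0 : R).
Proof.
move=> /cvgr0Pnorm_lt f2; apply/cvgr0Pnorm_lt => e e0.
have e20 : 0 < e ^+ 2 by rewrite exprn_gt0.
apply: filterS (f2 _ e20) => n; rewrite normrX ltr_pXn2r ?nnegrE//.
exact: ltW.
Qed.

Definition gram_eigenvector {R : realType} {k : scalar_kind} {E F : hilbertType R k}
  (T : boundedOp E F) (l : R) (u : E) := adjoint T (T u) = l%:K *: u.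

Section eigenvectors.
Context {R : realType} {k : scalar_kind} {E F : hilbertType R k}.
Variable T : boundedOp E F.
Local Notation eig := (gram_eigenvector T).

Lemma gramC x y : rin (adjoint T (T x)) y = rin x (adjoint T (T y)).
Proof. by rewrite rin_adjointl rin_adjoint. Qed.

Lemma eig_orth l m u v : eig l u -> eig m v -> l != m -> rin u v = 0.
Proof.
move=> lu mv lm; have := gramC u v; rewrite lu mv rinZl rinZr => /eqP.
by rewrite -subr_eq0 -mulrBl mulf_eq0 subr_eq0 (negPf lm) /= => /eqP.
Qed.

Lemma eig_sum_rin (s : seq (R * E)) (f g : R -> R) :
  (forall p, p \in s -> eig p.1 p.2) ->
  rin (\sum_(p <- s) (f p.1)%:K *: p.2) (\sum_(p <- s) (g p.1)%:K *: p.2) =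
  \sum_(p <- s) \sum_(q <- s) (f p.1 * g p.1) * rin p.2 q.2.
Proof.
move=> se; rewrite rin_suml; apply: eq_big_seq => p ps.
rewrite rin_sumr; apply: eq_big_seq => q qs; rewrite rinZl rinZr.
have [->|pq] := eqVneq p.1 q.1; first by rewrite mulrA.
by rewrite (eig_orth (se p ps) (se q qs) pq) !mulr0.
Qed.

Lemma eig_sum_le (s : seq (R * E)) (f g : R -> R) :
  (forall p, p \in s -> eig p.1 p.2) ->
  (forall p, p \in s -> 0 <= f p.1 <= g p.1) ->
  rnorm (\sum_(p <- s) (f p.1)%:K *: p.2) <= rnorm (\sum_(p <- s) (g p.1)%:K *: p.2).
Proof.
move=> se fg; rewrite ler_rnorm_sqr ?rnorm_ge0// -!rinxx -subr_ge0.
pose h l := Num.sqrt (g l ^+ 2 - f l ^+ 2).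
have -> : rin (\sum_(p <- s) (g p.1)%:K *: p.2) (\sum_(p <- s) (g p.1)%:K *: p.2) -
    rin (\sum_(p <- s) (f p.1)%:K *: p.2) (\sum_(p <- s) (f p.1)%:K *: p.2) =
    rin (\sum_(p <- s) (h p.1)%:K *: p.2) (\sum_(p <- s) (h p.1)%:K *: p.2).
  rewrite !eig_sum_rin// -sumrB; apply: eq_big_seq => p ps.
  rewrite -sumrB; apply: eq_bigr => q _; rewrite -mulrBl; congr (_ * _).
  have /andP[f0 fgp] := fg p ps; rewrite -!expr2 sqr_sqrtr// subr_ge0.
  by rewrite ler_pXn2r// nnegrE (le_trans f0).
by rewrite rinxx sqr_ge0.
Qed.

Definition eig_span (th : R) : set E :=
  [set x | exists2 s : seq (R * E),
     forall p, p \in s -> th <= p.1 /\ eig p.1 p.2 & x = \sum_(p <- s) p.2].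

Lemma eig_span_subspace th : real_subspace (eig_span th).
Proof.
split=> [|_ _ [s sP ->] [t tP ->]|a _ [s sP ->]].
- by exists [::] => //; rewrite big_nil.
- exists (s ++ t); last by rewrite big_cat.
  by move=> p; rewrite mem_cat => /orP[/sP|/tP].
- exists [seq (p.1, a%:K *: p.2) | p <- s]; last by rewrite big_map scaler_sumr.
  move=> _ /mapP[p ps ->] /=; have [thp pe] := sP p ps; split => //.
  by rewrite /gram_eigenvector !boundedOp_scalable pe !scalerA mulrC.
Qed.

Lemma eig_span1 th l u : th <= l -> eig l u -> eig_span th u.
Proof.
move=> thl lu; exists [:: (l, u)]; last by rewrite big_seq1.
by move=> p; rewrite inE => /eqP ->.
Qed.

Lemma boundedOp_sum (E' F' : normedModType (scalar R k)) (S : boundedOp E' F')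
  I (r : seq I) (G : I -> E') :
  S (\sum_(i <- r) G i) = \sum_(i <- r) S (G i).
Proof.
by apply: (big_morph S) => [x y|]; rewrite ?boundedOpD1 ?boundedOp0E.
Qed.

Lemma eig_span_preimage th x : 0 < th -> eig_span th x ->
  exists2 y, eig_span th y & x = adjoint T (T y) /\ rnorm y <= th^-1 * rnorm x.
Proof.
move=> th0 [s sP ->].
have s0 p : p \in s -> 0 < p.1 by move=> /sP[+ _]; exact: lt_le_trans.
exists (\sum_(p <- s) (p.1^-1)%:K *: p.2).
  exists [seq (p.1, p.1^-1%:K *: p.2) | p <- s]; last by rewrite big_map.
  move=> _ /mapP[p ps ->] /=; have [thp pe] := sP p ps; split => //.
  by rewrite /gram_eigenvector !boundedOp_scalable pe !scalerA mulrC.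
split.
  rewrite !boundedOp_sum; apply: eq_big_seq => p ps; have [thp pe] := sP p ps.
  rewrite !boundedOp_scalable pe scalerA -scalar_of_realM mulVf ?gt_eqF ?s0//.
  by rewrite scalar_of_real1 scale1r.
have <- : rnorm (\sum_(p <- s) (th^-1)%:K *: p.2) = th^-1 * rnorm (\sum_(p <- s) p.2).
  by rewrite -scaler_sumr rnormZr ger0_norm// invr_ge0 ltW.
apply: (@eig_sum_le s (fun l => l^-1) (fun=> th^-1)) => p ps.
  by have [] := sP p ps.
have [thp _] := sP p ps; rewrite invr_ge0 (ltW (s0 p ps)) /=.
by rewrite lef_pV2 ?posrE ?s0.
Qed.

Lemma eig_span_ge c x : 0 <= c -> eig_span (c ^+ 2) x -> c * rnorm x <= rnorm (T x).
Proof.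
move=> c0 [s sP ->].
have c20 : 0 <= c ^+ 2 by rewrite sqr_ge0.
have <- : rnorm (\sum_(p <- s) c%:K *: p.2) = c * rnorm (\sum_(p <- s) p.2).
  by rewrite -scaler_sumr rnormZr ger0_norm.
have -> : rnorm (T (\sum_(p <- s) p.2)) =
    rnorm (\sum_(p <- s) (Num.sqrt p.1)%:K *: p.2).
  apply/eqP; rewrite -(@eqrXn2 _ 2) ?rnorm_ge0//; apply/eqP; rewrite -!rinxx.
  rewrite -rin_adjointl !boundedOp_sum.
  rewrite (eq_big_seq (fun p : R * E => p.1%:K *: p.2)); last first.
    by move=> p /sP[_ ->].
  rewrite [X in rin _ X](eq_bigr (fun p : R * E => 1%:K *: p.2)); last first.
    by move=> p _; rewrite scalar_of_real1 scale1r.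
  rewrite (@eig_sum_rin s id (fun=> 1)) ?eig_sum_rin; try by move=> p /sP[].
  apply: eq_big_seq => p ps; apply: eq_bigr => q _; have [cp _] := sP p ps.
  by rewrite mulr1 -expr2 sqr_sqrtr//; exact: le_trans cp.
apply: (@eig_sum_le s (fun=> c) Num.sqrt) => p ps; have [cp pe] := sP p ps => //.
by rewrite c0 /= -{1}(ger0_norm c0) -sqrtr_sqr ler_wsqrtr.
Qed.

Lemma orthogonal_eigenvector (X : set E) (c : R) y :
  compact_op T -> (forall x, X x -> exists l, eig l x) -> 0 <= c ->
  (forall x, X x -> rin x y = 0) -> c * rnorm y < rnorm (T y) ->
  exists l z, [/\ c ^+ 2 < l, z != 0, eig l z & forall x, X x -> rin x z = 0].
Proof.
move=> Tc Xe c0 Xy cy.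
pose Y := [set z | forall x, X x -> rin x z = 0].
have YZ a z : Y z -> Y (a%:K *: z) by move=> Yz x Xx; rewrite rinZr Yz// mulr0.
have YT z : Y z -> Y (adjoint T (T z)).
  move=> Yz x Xx; have [l le] := Xe x Xx.
  by rewrite -gramC le rinZl Yz// mulr0.
pose V := [set rnorm (T z) | z in [set z | Y z /\ rnorm z <= 1]].
have Vsup : has_sup V.
  split; first by exists (rnorm (T 0)); exists 0 => //; split => [x _|]; rewrite ?rin0r ?rnorm0.
  exists (opnorm T) => _ [z [_ z1] <-]; exact: opnorm_ge.
set s := sup V.
have sub z : Y z -> rnorm (T z) <= s * rnorm z.
  move=> Yz; have [->|z0] := eqVneq z 0; first by rewrite boundedOp0E !rnorm0 mulr0.
  have zp : 0 < rnorm z by rewrite rnorm_gt0.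
  have : rnorm (T ((rnorm z)^-1%:K *: z)) <= s.
    apply: sup_upper_bound => //; exists ((rnorm z)^-1%:K *: z) => //; split; first exact: YZ.
    by rewrite rnormZr ger0_norm ?invr_ge0 ?rnorm_ge0// mulVf ?gt_eqF.
  rewrite boundedOp_scalable rnormZr ger0_norm ?invr_ge0 ?rnorm_ge0//.
  by rewrite mulrC ler_pdivrMr.
have y0 : 0 < rnorm y.
  rewrite rnorm_gt0; apply/eqP => y0; move: cy.
  by rewrite y0 boundedOp0E !rnorm0 mulr0 ltxx.
have cs : c < s by rewrite -(ltr_pM2r y0) (lt_le_trans cy)// sub.
have s0 : 0 < s by exact: le_lt_trans cs.
have s0' := ltW s0.
have zex n : exists z, [/\ Y z, rnorm z <= 1 & s - n.+1%:R^-1 < rnorm (T z)].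
  have e0 : 0 < n.+1%:R^-1 :> R by rewrite invr_gt0.
  by have [_ [z [Yz z1] <-] h] := sup_adherent e0 Vsup; exists z.
have [z zP] := choice zex.
have [U [UU Uoo]] := @ultraFilterLemma nat \oo _.
have [g Tzg] : exists g, rcvg U (fun n => T (z n)) g.
  by apply: (compact_op_ultra UU Tc (M := 1)) => n; have [] := zP n.
have Tzs : (fun n => rnorm (T (z n))) @ U --> s.
  have h : (fun n : nat => s - rnorm (T (z n))) @ \oo --> (0 : R).
    refine (cvg0_leW (@cvg_harmonic R) _) => n /=; have [Yz z1 h] := zP n.
    rewrite subr_ge0 (le_trans (sub _ Yz)) ?ler_piMr ?(ltW s0)//=.
    by rewrite lerBlDr -lerBlDl ltW.
  apply: (cvg_sub Uoo); rewrite -[X in _ --> X]subr0.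
  rewrite (_ : (fun n => _) = fun n => s - (s - rnorm (T (z n)))).
    by apply: cvgB => //; exact: cvg_cst.
  by apply/funext => n; rewrite opprB addrC subrK.
pose w n := adjoint T (T (z n)).
have wg : rcvg U w (adjoint T g) by exact: rcvg_op_cst.
have wz : rcvg U (fun n => w n - (s ^+ 2)%:K *: z n) 0.
  apply: cvg0_sqr.
  have h : (fun n => s ^+ 2 * (s ^+ 2 - rnorm (T (z n)) ^+ 2)) @ U --> (0 : R).
    rewrite -[X in _ --> X](mulr0 (s ^+ 2)); apply: cvgM; first exact: cvg_cst.
    rewrite -[X in _ --> X](subrr (s ^+ 2)); apply: cvgB; first exact: cvg_cst.
    by apply: cvgM.
  refine (cvg0_leW h _) => n; rewrite sqr_ge0 /= subr0.
  have [Yz z1 _] := zP n.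
  rewrite rnormB_sqr rinZr rnormZr ger0_norm ?sqr_ge0// /w rin_adjointl rinxx.
  have : rnorm (w n) <= s * rnorm (T (z n)).
    have [->|w0] := eqVneq (w n) 0; first by rewrite rnorm0 mulr_ge0 ?rnorm_ge0 ?ltW.
    have wp : 0 < rnorm (w n) by rewrite rnorm_gt0.
    rewrite -(ler_pM2r wp) -expr2 -rinxx {1}/w rin_adjointl.
    rewrite (le_trans (ler_rin _ _))// (mulrC s) -mulrA ler_wpM2l ?rnorm_ge0//.
    exact/sub/YT.
  rewrite -/(w n); have := rnorm_ge0 (w n); have := rnorm_ge0 (z n).
  have := rnorm_ge0 (T (z n)).
  move: (rnorm (w n)) (rnorm (T (z n))) (rnorm (z n)) z1 => a b d d1 b0 d0 a0 ab.
  have a2 : a ^+ 2 <= (s * b) ^+ 2 by rewrite ler_pXn2r// nnegrE (le_trans a0).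
  have d2 : (s ^+ 2 * d) ^+ 2 <= (s ^+ 2) ^+ 2.
    rewrite ler_pXn2r ?nnegrE ?mulr_ge0 ?sqr_ge0//.
    by rewrite -[leRHS]mulr1 ler_wpM2l ?sqr_ge0.
  by nra.
pose z' := (s ^+ 2)^-1%:K *: adjoint T g.
have s2 : s ^+ 2 != 0 by rewrite sqrf_eq0 gt_eqF.
have zz' : rcvg U z z'.
  have zE : z = fun n => (s ^+ 2)^-1%:K *: (w n - (w n - (s ^+ 2)%:K *: z n)).
    apply: funext => m; rewrite opprB addrC subrK scalerA -scalar_of_realM mulVf//.
    by rewrite scalar_of_real1 scale1r.
  rewrite zE; refine (rcvgZr (cvg_cst _) _).
  by rewrite -[adjoint T g]subr0; refine (rcvgB wg wz).
have Tz's : rnorm (T z') = s.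
  by apply: cvg_unique Tzs => //; apply: rcvg_rnorm; exact: rcvg_op_cst.
exists (s ^+ 2), z'; split.
- by rewrite ltr_pXn2r// nnegrE ltW.
- by apply/eqP => z'0; move: s0; rewrite -Tz's z'0 boundedOp0E rnorm0 ltxx.
- rewrite /gram_eigenvector scalerA -scalar_of_realM mulfV// scalar_of_real1 scale1r.
  by refine (rcvg_unique _ wg); do 2 apply: rcvg_op_cst.
- move=> x Xx; have h : (fun n => rin x (z n)) @ U --> rin x z'.
    by apply: rcvg_rin => //; exact: rcvg_cst.
  apply: cvg_unique h _ => //; rewrite (_ : (fun n => _) = fun=> 0).
    exact: cvg_cst.
  by apply/funext => n; have [Yz _ _] := zP n; rewrite Yz.
Qed.

Lemma orthogonal_eig_le (c : R) y : compact_op T -> 0 <= c ->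
  (forall l x, c ^+ 2 < l -> eig l x -> rin x y = 0) ->
  rnorm (T y) <= c * rnorm y.
Proof.
move=> Tc c0 cy; rewrite leNgt; apply/negP => yT.
have [|x [l []]|l [z [cl z0 lz zX]]] := @orthogonal_eigenvector
    [set x | exists2 l, c ^+ 2 < l & eig l x] c y Tc _ c0 _ yT.
- by move=> x [l _ lx]; exists l.
- exact: cy.
have /eqP := zX z (ex_intro2 _ _ l cl lz).
by rewrite rinxx sqrf_eq0 => /eqP/rnorm0_eq0/eqP; rewrite (negPf z0).
Qed.

End eigenvectors.

Section span_theory.
Context {K : numFieldType} {E : lmodType K}.

Lemma span_gen (N : nat) (b : 'I_N -> E) i : span b (b i).
Proof.
exists (fun j => (j == i)%:R); rewrite (bigD1 i)//= eqxx scale1r big1 ?addr0// => j ji.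
by rewrite (negPf ji) scale0r.
Qed.

Lemma span0 (N : nat) (b : 'I_N -> E) : span b 0.
Proof. by exists (fun=> 0); rewrite big1// => i _; rewrite scale0r. Qed.

Lemma spanD (N : nat) (b : 'I_N -> E) x y : span b x -> span b y -> span b (x + y).
Proof.
move=> [c ->] [d ->]; exists (fun i => c i + d i); rewrite -big_split/=.
by apply: eq_bigr => i _; rewrite scalerDl.
Qed.

Lemma spanN (N : nat) (b : 'I_N -> E) x : span b x -> span b (- x).
Proof.
move=> [c ->]; exists (fun i => - c i); rewrite -sumrN.
by apply: eq_bigr => i _; rewrite scaleNr.
Qed.

Lemma span_neq0 (N : nat) (b : 'I_N -> E) :
  (0 < N)%N -> lin_indep b -> ~ span b `<=` [set 0].
Proof.
move=> N0 bi b0; have := bi (fun=> 1) _ (Ordinal N0).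
rewrite big1 => [/(_ erefl)/eqP|i _]; first by rewrite oner_eq0.
by rewrite (b0 _ (span_gen b i)) scaler0.
Qed.

Lemma eigenspace_sum_widen (T : E -> E) (l : nat -> K) r : T 0 = 0 ->
  eigenspace_sum T l r `<=` eigenspace_sum T l r.+1.
Proof.
move=> T0 _ [u uP ->]; exists (fun j => if (j <= r)%N then u j else 0).
  move=> j /andP[j0 _]; case: ifPn => jr; first by apply: uP; rewrite j0.
  by rewrite /ker_sub /= T0 scaler0.
rewrite [RHS]big_nat_recr//= ltnn addr0.
by apply: eq_big_nat => j /andP[_]; rewrite ltnS => ->.
Qed.

Lemma eigenspace_sum0 (T : E -> E) (l : nat -> K) x :
  eigenspace_sum T l 0 x -> x = 0.
Proof. by move=> [u _ ->]; rewrite big_geq. Qed.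

Lemma ker_sub_eigenspace_sum (T : E -> E) (l : nat -> K) r j x : T 0 = 0 ->
  (0 < j <= r)%N -> ker_sub T (l j) x -> eigenspace_sum T l r x.
Proof.
move=> T0 /andP[j0 jr] jx; exists (fun i => if i == j then x else 0).
  by move=> i _; case: eqP => [->//|_]; rewrite /ker_sub /= T0 scaler0.
rewrite (big_cat_nat _ (n := j)) ?ltnS ?(leqW jr)//= big_nat_cond big1 ?add0r; last first.
  by move=> i; rewrite andbT => /andP[_ /ltn_eqF ->].
rewrite big_ltn ?ltnS// eqxx big_nat_cond big1 ?addr0// => i.
by rewrite andbT => /andP[/gtn_eqF ->].
Qed.

(* lowers r until E_{m,N} is no longer contained in the sum of the first r-1
   eigenspaces *)
Lemma eigenspace_sum_minimal (T : E -> E) (l : nat -> K) (r : nat) (V : set E) :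
  T 0 = 0 -> ~ V `<=` [set 0] ->
  eigenspace_sum T l r.-1 `<=` V -> V `<=` eigenspace_sum T l r ->
  exists q, [/\ (q < r)%N, eigenspace_sum T l q `<=` V,
    V `<=` eigenspace_sum T l q.+1 & ~ V `<=` eigenspace_sum T l q].
Proof.
move=> T0 V0; elim: r => [_ Vr|r IH rV Vr].
  by exfalso; apply: V0 => x /Vr /eigenspace_sum0.
have [Vr'|Vr'] := pselect (V `<=` eigenspace_sum T l r); last by exists r.
have [|q [qr qV Vq Vq']] := IH _ Vr'.
  case: r rV {IH Vr Vr'} => [//|r] rV /=.
  exact: subset_trans (eigenspace_sum_widen T0) rV.
by exists q; split => //; exact: ltnW.
Qed.

End span_theory.

Lemma singular_gram {K : fieldType} (N : nat) (G : 'I_N -> 'I_N -> K) (c : 'I_N -> K) :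
  (exists j, c j != 0) -> (forall i, \sum_j G i j * c j = 0) ->
  exists2 d : 'I_N -> K, (exists i, d i != 0) & forall j, \sum_i d i * G i j = 0.
Proof.
move=> [j0 cj0] Gc; pose A := \matrix_(i, j) G i j.
have : \det A^T == 0.
  apply/det0P; exists (\row_j c j).
    by apply/eqP => /rowP/(_ j0); rewrite !mxE; apply/eqP.
  apply/rowP => i; rewrite !mxE; under eq_bigr do rewrite !mxE mulrC.
  exact: Gc.
rewrite det_tr => /det0P[v v0 vA]; exists (fun i => v ord0 i).
  by have /rV0Pn[i vi] := v0; exists i.
move=> j; have /rowP/(_ j) := vA; rewrite !mxE.
by under eq_bigr do rewrite !mxE.
Qed.

Section first_singular.
Context {R : realType} {k : scalar_kind} {E F : hilbertType R k}.
Local Notation K := (scalar R k).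

Lemma scalar_of_real_inj : injective (@scalar_of_real R k).
Proof. by move=> a b /(congr1 (@scalar_re R k)); rewrite !scalar_of_realK. Qed.

Lemma ltr_scalar_of_real (a b : R) : (a%:K < b%:K :> K) = (a < b).
Proof. by rewrite !lt_def ler_scalar_of_real (inj_eq scalar_of_real_inj). Qed.

Lemma inner_eq0 (x y : E) : (forall d : K, rin (d *: x) y = 0) -> inner x y = 0.
Proof.
move=> xy; apply: scalar_re_conjM_eq0.
by have := xy (scalar_conj (inner x y)); rewrite /rin linearZl_LR.
Qed.

Lemma inner_sumZr (I : Type) (r : seq I) (e : I -> K) (G : I -> E) x :
  inner x (\sum_(j <- r) e j *: G j) = \sum_(j <- r) inner x (G j) * scalar_conj (e j).
Proof. by rewrite linear_sumr; under eq_bigr do rewrite linearZr_LR /= mulrC. Qed.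

Lemma inner_sumZl (I : Type) (r : seq I) (e : I -> K) (G : I -> E) x :
  inner (\sum_(j <- r) e j *: G j) x = \sum_(j <- r) e j * inner (G j) x.
Proof. by rewrite linear_sumlz; under eq_bigr do rewrite linearZl_LR. Qed.

Variable T : boundedOp E F.
Local Notation eig := (gram_eigenvector T).
Local Notation TT := (adjoint T \o T).
Hypothesis T_inj : forall x, T x = 0 -> x = 0.

Lemma gram_eigenvalue_real (l : K) :
  is_eigenvalue TT l -> exists2 a : R, l = a%:K & 0 < a.
Proof.
move=> [x x0]; rewrite /ker_sub /= => lx.
have xn : 0 < rnorm x by rewrite rnorm_gt0.
have Tn : 0 < rnorm (T x) by rewrite rnorm_gt0; apply: contra_neq x0; exact: T_inj.
exists (rnorm (T x) ^+ 2 / rnorm x ^+ 2); last by rewrite divr_gt0 ?exprn_gt0.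
have h : (rnorm (T x) ^+ 2)%:K = scalar_conj l * (rnorm x ^+ 2)%:K.
  rewrite 2!expr2 !scalar_of_realM !rnormE -!expr2 !inner_norm.
  by rewrite inner_adjoint lx linearZr_LR.
apply: (can_inj scalar_conjK); rewrite scalar_conjr scalar_of_realM h -mulrA.
rewrite -scalar_of_realM mulfV ?scalar_of_real1 ?mulr1//.
by rewrite sqrf_eq0 gt_eqF.
Qed.

Lemma nth_eigenvalue_decr (l : nat -> K) r i j :
  (forall j, (0 < j <= r)%N -> is_nth_eigenvalue TT j (l j)) ->
  (0 < i)%N -> (i < j)%N -> (j <= r)%N -> l j < l i.
Proof.
move=> lP i0 ij jr.
have [_ ei ci] : is_nth_eigenvalue TT i (l i) by apply: lP; lia.
have [_ ej cj] : is_nth_eigenvalue TT j (l j) by apply: lP; lia.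
have [a la _] := gram_eigenvalue_real ei; have [b lb _] := gram_eigenvalue_real ej.
rewrite la lb ltr_scalar_of_real ltNge; apply/negP => ab.
have : (`I_(j.-1) #<= `I_(i.-1))%card.
  rewrite -(card_le_eql cj) -(card_le_eqr ci); apply: subset_card_le => m /= [em jm].
  by split => //; apply: le_lt_trans jm; rewrite la lb ler_scalar_of_real.
by rewrite card_le_II; lia.
Qed.

Lemma above_nth_eigenvalue (l : nat -> K) r (m : K) :
  (forall j, (0 < j <= r)%N -> is_nth_eigenvalue TT j (l j)) -> (0 < r)%N ->
  is_eigenvalue TT m -> l r < m -> exists2 j, (0 < j < r)%N & m = l j.
Proof.
move=> lP r0 me rm; apply: contrapT => nm.
have [_ er cr] : is_nth_eigenvalue TT r (l r) by apply: lP; lia.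
pose f j := if (j < r.-1)%N then l j.+1 else m.
have fi : {in `I_r &, injective f}.
  move=> i j; rewrite !inE /= /f => ir jr; case: ifPn => h1; case: ifPn => h2 e.
  - apply/eqP; case: (ltngtP i j) => // h.
      have := @nth_eigenvalue_decr l r i.+1 j.+1 lP; rewrite e ltxx => h'; suff : false by [].
      by apply: h'; lia.
    have := @nth_eigenvalue_decr l r j.+1 i.+1 lP; rewrite e ltxx => h'; suff : false by [].
    by apply: h'; lia.
  - by exfalso; apply: nm; exists i.+1 => //; lia.
  - by exfalso; apply: nm; exists j.+1 => //; lia.
  - lia.
have : (`I_r #<= `I_(r.-1))%card.
  rewrite -(card_le_eql (inj_card_eq fi)) -(card_le_eqr cr).
  apply: subset_card_le => _ [j /= jr <-]; rewrite /f; case: ifPn => h //=.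
  have [_ ej _] : is_nth_eigenvalue TT j.+1 (l j.+1) by apply: lP; lia.
  by split => //; apply: (@nth_eigenvalue_decr _ r) => //; lia.
by rewrite card_le_II; lia.
Qed.

Lemma first_singular_bound (N : nat) (V : set E) : compact_op T -> (0 < N)%N ->
  first_singular_space T N V ->
  exists2 s : R, 0 < s & V `<=` eig_span T (s ^+ 2) /\
    forall (W : set E) (c : R), is_subspace_of_dim W N -> 0 <= c ->
      (forall w, W w -> c * rnorm w <= rnorm (T w)) -> c <= s.
Proof.
move=> Tc N0 [[b bi VE] Vl].
have T0 : TT 0 = 0 by rewrite /= !boundedOp0E.
have [r [l [r0 lP rV Vr]]] : exists r l, [/\ (0 < r)%N,
    forall j, (0 < j <= r)%N -> is_nth_eigenvalue TT j (l j),
    eigenspace_sum TT l r.-1 `<=` V & V `<=` eigenspace_sum TT l r].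
  case: Vl => [[l l1 Vl]|//]; exists 1%N, (fun=> l); split => //.
  - by move=> j; case: j => [//|[|//]].
  - by move=> x /eigenspace_sum0 ->; rewrite VE; exact: span0.
  - by move=> x /Vl Vx; exists (fun=> x) => //; rewrite big_nat1.
have V0 : ~ V `<=` [set 0] by rewrite VE; exact: span_neq0.
have [q [qr qV Vq /existsNP[v /not_implyP[Vv Nv]]]] := eigenspace_sum_minimal T0 V0 rV Vr.
have {}lP j : (0 < j <= q.+1)%N -> is_nth_eigenvalue TT j (l j).
  by move=> jq; apply: lP; lia.
have lr j : (0 < j <= q.+1)%N -> exists2 a : R, l j = a%:K & 0 < a.
  by move=> jq; have [_ ej _] := lP _ jq; exact: gram_eigenvalue_real.
have eigK j x : (0 < j <= q.+1)%N -> ker_sub TT (l j) x -> eig (re (l j)) x.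
  move=> jq; have [a -> _] := lr _ jq.
  by rewrite /ker_sub /gram_eigenvector /= scalar_of_realK.
have [a la a0] := lr q.+1 (ltac:(lia)).
have [u uP vu] := Vq v Vv; set v0 := u q.+1.
have v0e : eig a v0.
  have v0l : ker_sub TT (l q.+1) v0 by apply: uP; lia.
  by have := eigK q.+1 v0 (ltac:(lia)) v0l; rewrite la scalar_of_realK.
have v0E : v = \sum_(1 <= j < q.+1) u j + v0 by rewrite vu big_nat_recr.
have SV : V (\sum_(1 <= j < q.+1) u j).
  by apply: qV; exists u => // j jq; apply: uP; lia.
have Vv0 : V v0.
  have -> : v0 = v - \sum_(1 <= j < q.+1) u j by rewrite v0E addrC addrA addNr add0r.
  by move: Vv SV; rewrite VE => Vv SV; apply: spanD => //; exact: spanN.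
have v00 : v0 != 0.
  apply/eqP => v00; apply: Nv; rewrite v0E v00 addr0; exists u => // j jq.
  by apply: uP; lia.
exists (Num.sqrt a); first by rewrite sqrtr_gt0.
rewrite sqr_sqrtr ?(ltW a0)//; split.
  move=> x /Vq [w wP ->].
  exists [seq (re (l j), w j) | j <- index_iota 1 q.+2]; last by rewrite big_map.
  move=> _ /mapP[j + ->] /=; rewrite mem_index_iota => jq; split; last first.
    by apply: eigK; [|apply: wP]; lia.
  have [a' la' _] := lr j (ltac:(lia)); rewrite la' scalar_of_realK.
  have [jq1|jq1] := ltnP j q.+1; last first.
    have jE : j = q.+1 by lia.
    by rewrite -(@ler_scalar_of_real R k) -la -la' jE.
  have := nth_eigenvalue_decr lP (i := j) (j := q.+1).
  by rewrite la la' ltr_scalar_of_real => h; apply/ltW/h; lia.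
move=> W c [w wi WE] c0 cW.
have ov0 : inner v0 v0 != 0.
  by rewrite -inner_norm sqrf_eq0 normr_eq0.
pose pr x := inner x v0 / inner v0 v0.
have [d dv0] : exists d : 'I_N -> K, v0 = \sum_i d i *: b i.
  by move: Vv0; rewrite VE => -[d ->]; exists d.
have dN : exists j, scalar_conj (d j) != 0.
  apply: contrapT => /forallNP dN; move/eqP: v00; apply; rewrite dv0 big1// => i _.
  have /negP := dN i; rewrite negbK => /eqP di.
  have -> : d i = 0 by rewrite -(scalar_conjK (d i)) di -(@scalar_of_real0 R k) scalar_conjr.
  by rewrite scale0r.
pose b' j := b j - pr (b j) *: v0.
have b'E (e : 'I_N -> K) : \sum_j e j *: b' j =
    \sum_j e j *: b j - pr (\sum_j e j *: b j) *: v0.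
  rewrite /b' /pr; under eq_bigr do rewrite scalerBr scalerA.
  rewrite sumrB -scaler_suml; congr (_ - _ *: _).
  by rewrite inner_sumZl mulr_suml; under eq_bigr do rewrite mulrA.
have [y [i0 yi0] yG] : exists2 y : 'I_N -> K, (exists i, y i != 0) &
    forall j, \sum_i y i * inner (w i) (b' j) = 0.
  apply: (singular_gram dN) => i.
  have := congr1 (inner (w i)) (b'E d); rewrite -dv0 /pr divff// scale1r subrr linear0r.
  by rewrite inner_sumZr.
pose z := \sum_i y i *: w i.
have Wz : W z by rewrite WE; exists y.
have z0 : 0 < rnorm z.
  by rewrite rnorm_gt0; apply/eqP => z0; move/eqP: yi0; apply; exact: wi _ z0 i0.
have zb j : inner z (b' j) = 0.
  by rewrite inner_sumZl.
have zV x : V x -> inner x v0 = 0 -> inner z x = 0.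
  rewrite VE => -[e xe] xv0; have := b'E e; rewrite -xe /pr xv0 mul0r scale0r subr0 => <-.
  by rewrite inner_sumZr big1// => j _; rewrite zb mul0r.
rewrite -(ler_pM2r z0) (le_trans (cW _ Wz))//.
apply: orthogonal_eig_le (sqrtr_ge0 _) _ => // m x; rewrite sqr_sqrtr ?(ltW a0)// => am mx.
have [->|x0] := eqVneq x 0; first by rewrite rin0l.
have me : is_eigenvalue TT m%:K by exists x.
have [||j jq mj] := above_nth_eigenvalue lP _ me; [by []|by rewrite la ltr_scalar_of_real|].
have Vx : V x.
  by apply: qV; apply: (@ker_sub_eigenspace_sum _ _ _ _ _ j) => //; rewrite -mj.
rewrite rinC /rin zV ?scalar_re0//; apply: inner_eq0 => e.
apply: (eig_orth (l := m) (m := a) _ v0e); last by rewrite gt_eqF.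
by rewrite /gram_eigenvector !boundedOp_scalable mx !scalerA mulrC.
Qed.

End first_singular.

Section eig_span_distance.
Context {R : realType} {k : scalar_kind} {E F : hilbertType R k}.
Variables (T T' : boundedOp E F) (c : R).
Hypotheses (T_compact : compact_op T) (c_gt0 : 0 < c).

Let X := eig_span T ((c / 2) ^+ 2).
Let e := (opnorm T + opnorm T') * opnorm (T' - T).

Let c2_ge0 : 0 <= c / 2. Proof. by rewrite divr_ge0// ltW. Qed.

Let X_orth_le z : (forall x, X x -> rin x z = 0) -> rnorm (T z) <= c / 2 * rnorm z.
Proof.
move=> zX; apply: orthogonal_eig_le => // l x cl lx; apply: zX.
by apply: eig_span1 lx; exact: ltW.
Qed.

Let X_orth_gram z : (forall x, X x -> rin x z = 0) ->
  (forall x, X x -> rin x (adjoint T (T z)) = 0).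
Proof.
move=> zX x [s sP ->]; rewrite rin_suml big_seq big1// => p ps.
have [cp pe] := sP p ps; rewrite -gramC pe rinZl zX ?mulr0//.
exact: eig_span1 pe.
Qed.

Let X_orth_gram_le z : (forall x, X x -> rin x z = 0) ->
  rnorm (adjoint T (T z)) <= (c / 2) ^+ 2 * rnorm z.
Proof.
move=> zX; set w := adjoint T (T z).
have [->|w0] := eqVneq w 0; first by rewrite rnorm0 mulr_ge0 ?sqr_ge0 ?rnorm_ge0.
have wp : 0 < rnorm w by rewrite rnorm_gt0.
rewrite -(ler_pM2r wp) -expr2 -rinxx {1}/w rin_adjointl (le_trans (ler_rin _ _))//.
have -> : (c / 2) ^+ 2 * rnorm z * rnorm w = c / 2 * rnorm z * (c / 2 * rnorm w).
  by ring.
by rewrite ler_pM ?rnorm_ge0// X_orth_le//; exact: X_orth_gram.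
Qed.

Let gram_perturb x z :
  `|rin (T' x) (T' z) - rin (T x) (T z)| <= e * (rnorm x * rnorm z).
Proof.
have -> : rin (T' x) (T' z) - rin (T x) (T z) =
    rin ((T' - T) x) (T' z) + rin (T x) ((T' - T) z).
  by rewrite /= rinBl rinBr; ring.
rewrite (le_trans (ler_normD _ _))// /e.
have h1 := ler_norm_rin ((T' - T) x) (T' z).
have h2 := ler_norm_rin (T x) ((T' - T) z).
have h3 : rnorm ((T' - T) x) * rnorm (T' z) <=
    (opnorm (T' - T) * rnorm x) * (opnorm T' * rnorm z).
  by rewrite ler_pM ?rnorm_ge0 ?opnormP.
have h4 : rnorm (T x) * rnorm ((T' - T) z) <=
    (opnorm T * rnorm x) * (opnorm (T' - T) * rnorm z).
  by rewrite ler_pM ?rnorm_ge0 ?opnormP.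
by rewrite (le_trans (lerD (le_trans h1 h3) (le_trans h2 h4)))//; lra.
Qed.

(* psi = T'^* T' beta, and replacing T'^* T' by T^* T moves T^* T onto z, where it
   has norm at most c^2 / 4: each round gains a factor 1 / 4 at the price e / c^2 *)
Let eig_span_almost_orth_iter n z psi : (forall x, X x -> rin x z = 0) ->
  eig_span T' (c ^+ 2) psi ->
  `|rin psi z| <= (2^-1 ^+ n + 2 * e / c ^+ 2) * (rnorm psi * rnorm z).
Proof.
have c20 : 0 < c ^+ 2 by rewrite exprn_gt0.
have e0 : 0 <= e by rewrite mulr_ge0 ?addr_ge0 ?opnorm_ge0.
have ec0 : 0 <= e / c ^+ 2 by rewrite divr_ge0// ltW.
elim: n z psi => [|n IH] z psi zX psiX.
  rewrite expr0 (le_trans (ler_norm_rin _ _))// ler_peMl ?mulr_ge0 ?rnorm_ge0//.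
  by rewrite lerDl -mulrA mulr_ge0.
have [b bX [psiE bpsi]] := eig_span_preimage c20 psiX.
have zX' := X_orth_gram zX.
have h1 := IH _ _ zX' bX.
have h2 := gram_perturb b z.
have h3 := X_orth_gram_le zX.
have -> : rin psi z = (rin (T' b) (T' z) - rin (T b) (T z)) + rin b (adjoint T (T z)).
  by rewrite -rin_adjoint subrK psiE rin_adjointl.
rewrite (le_trans (ler_normD _ _))//.
have n0 : 0 <= (2^-1 : R) ^+ n by rewrite exprn_ge0 ?invr_ge0.
have z0 := rnorm_ge0 z; have b0 := rnorm_ge0 b; have p0 := rnorm_ge0 psi.
have h4 : rnorm b * rnorm (adjoint T (T z)) <=
    (c ^+ 2)^-1 * rnorm psi * ((c / 2) ^+ 2 * rnorm z).
  by rewrite ler_pM ?rnorm_ge0.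
have h5 : e * (rnorm b * rnorm z) <= e * ((c ^+ 2)^-1 * rnorm psi * rnorm z).
  by rewrite ler_wpM2l// ler_wpM2r.
have h6 : (c ^+ 2)^-1 * rnorm psi * ((c / 2) ^+ 2 * rnorm z) =
    4^-1 * (rnorm psi * rnorm z).
  by field; rewrite gt_eqF.
rewrite h6 in h4.
have h7 : `|rin b (adjoint T (T z))| <=
    (2^-1 ^+ n + 2 * e / c ^+ 2) * (4^-1 * (rnorm psi * rnorm z)).
  by rewrite (le_trans h1)// ler_wpM2l// addr_ge0// -mulrA mulr_ge0.
rewrite (le_trans (lerD (le_trans h2 h5) h7))//.
rewrite (exprS _ n); move: (2^-1 ^+ n) n0 => a a0.
have pz := mulr_ge0 p0 z0.
have -> : e * ((c ^+ 2)^-1 * rnorm psi * rnorm z) = e / c ^+ 2 * (rnorm psi * rnorm z).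
  by rewrite !mulrA.
rewrite -(mulrA 2).
move: (e / c ^+ 2) ec0 (rnorm psi * rnorm z) pz => q q0 pz pz0.
have := mulr_ge0 a0 pz0; have := mulr_ge0 q0 pz0.
by nra.
Qed.

Let eig_span_almost_orth z psi : (forall x, X x -> rin x z = 0) ->
  eig_span T' (c ^+ 2) psi ->
  `|rin psi z| <= 2 * e / c ^+ 2 * (rnorm psi * rnorm z).
Proof.
move=> zX psiX.
have h : (fun n => (2^-1 ^+ n + 2 * e / c ^+ 2) * (rnorm psi * rnorm z)) @ \oo -->
    2 * e / c ^+ 2 * (rnorm psi * rnorm z).
  apply: cvgM; last exact: cvg_cst.
  rewrite -[X in _ --> X]add0r; apply: cvgD; last exact: cvg_cst.
  by apply: cvg_expr; rewrite ger0_norm ?invr_ge0// invf_lt1// ltr1n.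
refine (cvg_le (cvg_cst _) h _); apply: nearW => n.
exact: eig_span_almost_orth_iter.
Qed.

Lemma eig_span_dist phi psi :
  eig_span T (c ^+ 2) phi -> eig_span T' (c ^+ 2) psi ->
  rnorm (phi - psi) <= 2 / c * rnorm (T (phi - psi)) +
    (2 / c * opnorm T + 1) * (2 / c ^+ 2 * (opnorm T + opnorm T')) *
    (opnorm (T' - T) * rnorm psi).
Proof.
move=> phiX psiX.
have [x [z [u [dE uX ux zX]]]] :=
  orthogonal_decomposition (phi - psi) (eig_span_subspace T ((c / 2) ^+ 2)).
have zX' y : X y -> rin y z = 0 by move=> Xy; rewrite rinC zX.
have xz : rin x z = 0.
  have h : (fun n => rin (u n) z) @ \oo --> rin x z.
    by apply: rcvg_rin => //; exact: rcvg_cst.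
  have uz : (fun n => rin (u n) z) = fun=> 0 by apply/funext => n; exact: zX' (uX n).
  by rewrite uz in h; refine (cvg_unique _ h (cvg_cst _)).
have phiz : rin phi z = 0.
  apply: zX'; have [s sP ->] := phiX; exists s => // p /sP[cp pe]; split => //.
  rewrite (le_trans _ cp)// ler_pXn2r ?nnegrE ?(ltW c_gt0)//.
  by rewrite ler_pdivrMr// ler_peMr ?(ltW c_gt0)// ler1n.
have zn : rnorm z <= 2 * e / c ^+ 2 * rnorm psi.
  have [->|z0] := eqVneq z 0.
    rewrite rnorm0 !mulr_ge0 ?rnorm_ge0 ?addr_ge0 ?opnorm_ge0 ?invr_ge0//.
    by rewrite exprn_ge0// ltW.
  have zp : 0 < rnorm z by rewrite rnorm_gt0.
  rewrite -(ler_pM2r zp) -expr2; have := eig_span_almost_orth zX' psiX.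
  rewrite mulrA; apply: le_trans.
  have -> : rnorm z ^+ 2 = - rin psi z.
    rewrite -rinxx -[LHS]add0r -xz -rinDl -dE rinBl phiz add0r //.
  by rewrite -normrN ler_norm.
have xn : c / 2 * rnorm x <= rnorm (T x).
  refine (cvg_le (cvgM (cvg_cst _) (rcvg_rnorm ux)) (rcvg_rnorm (rcvg_op_cst T ux)) _).
  by apply: nearW => n; exact: eig_span_ge.
have Tx : rnorm (T x) <= rnorm (T (phi - psi)) + opnorm T * rnorm z.
  have -> : x = (phi - psi) - z by rewrite dE addrK.
  rewrite boundedOpB1 (le_trans (rnormD _ _))// rnormN lerD2l; exact: opnormP.
have xn' : rnorm x <= 2 / c * (rnorm (T (phi - psi)) + opnorm T * rnorm z).
  have -> : rnorm x = 2 / c * (c / 2 * rnorm x) by field; rewrite gt_eqF.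
  by rewrite ler_wpM2l ?divr_ge0 ?(ltW c_gt0)//; exact: le_trans xn Tx.
rewrite {1}dE (le_trans (rnormD _ _))// (le_trans (lerD xn' (lexx _)))//.
rewrite mulrDr -addrA lerD2l.
have -> : 2 / c * (opnorm T * rnorm z) + rnorm z = (2 / c * opnorm T + 1) * rnorm z.
  by ring.
rewrite -[leRHS]mulrA ler_wpM2l//.
  by rewrite addr_ge0// mulr_ge0 ?opnorm_ge0// divr_ge0 ?(ltW c_gt0).
by rewrite (le_trans zn)// le_eqVlt; apply/orP; left; apply/eqP; rewrite /e; ring.
Qed.

End eig_span_distance.

Lemma MVT01 {R : realType} (g dg : R -> R) :
  (forall t : R, t \in `[0, 1]%R -> is_derive t 1 g (dg t)) ->
  exists2 t, t \in `[0, 1]%R & g 1 - g 0 = dg t.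
Proof.
move=> gP.
have h1 (x : R) : x \in `]0, 1[ -> is_derive x 1 g (dg x).
  rewrite in_itv /= => /andP[x0 x1].
  by apply: gP; rewrite in_itv /= !ltW.
have h2 : {within `[0, 1], continuous g}.
  apply: derivable_within_continuous => x x01.
  exact: (@ex_derive _ _ _ _ _ _ _ (gP x x01)).
have [t t01 gt] := @MVT R g dg 0 1 (@ltr01 R) h1 h2.
exists t; last by rewrite gt subr0 mulr1.
by move: t01; rewrite !in_itv /= => /andP[t0 t1]; rewrite !ltW.
Qed.

Section strict_differentiability.
Context {R : realType} {k : scalar_kind} {E F : hilbertType R k} {p : nat}.
Implicit Types (A : 'rV[R]_p -> boundedOp E F) (x y h : 'rV[R]_p).

Lemma is_derive_rin A x h u v (t : R) : differentiable A (x + t *: h) ->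
  is_derive t 1 (fun s : R => rin (A (x + s *: h) u) v)
    (rin ('D_h A (x + t *: h) u) v).
Proof.
move=> dA; set D := 'D_h A _; set g := (fun s : R => _).
have QD : (fun s : R => s^-1 *: ((A \o shift (x + t *: h)) (s *: h) - A (x + t *: h)))
    @ 0^' --> D by exact: (diff_derivable (v := h) dA).
have gD : (fun s : R => s^-1 *: ((g \o shift t) (s *: (1 : R)) - g t)) @ 0^' -->
    rin (D u) v.
  apply/subr_cvg0/norm_cvg0P.
  have h0 : (fun s : R => `|s^-1 *: ((A \o shift (x + t *: h)) (s *: h) -
      A (x + t *: h)) - D| * (rnorm u * rnorm v)) @ 0^' --> (0 : R).
    rewrite -[X in _ --> X](mul0r (rnorm u * rnorm v)).
    apply: cvgM; last exact: cvg_cst.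
    by apply/norm_cvg0P/subr_cvg0.
  refine (cvg0_leW h0 _) => s; rewrite normr_ge0 /=.
  pose Q := s^-1 *: (A (s *: h + (x + t *: h)) - A (x + t *: h)).
  rewrite -/Q.
  have -> : s^-1 *: (g (s *: 1 + t) - g t) - rin (D u) v = rin ((Q - D) u) v.
    rewrite /= rinBl /Q /= rinZl rinBl /g scalerDl (addrCA x).
    by rewrite [s%:A]mulr1.
  rewrite (le_trans (ler_norm_rin _ _))// mulrA ler_wpM2r ?rnorm_ge0//.
  exact: opnormP.
apply: DeriveDef; first exact: (cvgP _ gD).
exact: (cvg_lim _ gD).
Qed.

Lemma derive_row A x h : differentiable A x ->
  'D_h A x = \sum_j h ord0 j *: 'D_(delta_mx 0 j) A x.
Proof.
move=> dA; rewrite deriveE// {1}(row_sum_delta h) linear_sum.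
by apply: eq_bigr => j _; rewrite linearZ deriveE.
Qed.

Lemma strict_differentiability (B : set 'rV[R]_p) A a (e : R) :
  open B -> C1_on B A -> B a -> 0 < e ->
  exists2 r : R, 0 < r & forall x y, `|a - x| < r -> `|a - y| < r ->
    opnorm (A x - A y - \sum_j (x - y) ord0 j *: 'D_(delta_mx 0 j) A a)
      <= e * \sum_j `|(x - y) ord0 j|.
Proof.
move=> Bo [Ad Ac] Ba e0.
have nearB : \forall z \near a, B z /\
    forall j, `|'D_(delta_mx 0 j) A a - 'D_(delta_mx 0 j) A z| < e.
  have h1 : \forall z \near a, B z by exact: open_nbhs_nbhs.
  have h2 : \forall z \near a, forall j,
      `|'D_(delta_mx 0 j) A a - 'D_(delta_mx 0 j) A z| < e.
    have := @filter_forall 'rV[R]_p 'I_p (fun j z =>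
      `|'D_(delta_mx 0 j) A a - 'D_(delta_mx 0 j) A z| < e) (nbhs a) (nbhs_filter a).
    apply => j; by have /cvgrPdist_lt := Ac (delta_mx 0 j) a Ba; apply.
  by move: h1 h2; apply: filterS2.
have [r /= r0 rB] := (nbhs_ballP _ _).1 nearB.
have {}rB z : `|a - z| < r -> B z /\
    forall j, `|'D_(delta_mx 0 j) A a - 'D_(delta_mx 0 j) A z| < e.
  by move=> az; apply: rB; rewrite -ball_normE.
exists r => // x y ax ay; set h := x - y.
have seg (t : R) : t \in `[0, 1]%R -> `|a - (y + t *: h)| < r.
  rewrite in_itv /= => /andP[t0 t1].
  have -> : a - (y + t *: h) = (1 - t) *: (a - y) + t *: (a - x).
    rewrite /h !scalerBr !scalerBl !scale1r !opprB !opprD.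
    by apply/rowP => i; rewrite !mxE; ring.
  rewrite (le_lt_trans (ler_normD _ _))// !normrZ (ger0_norm t0) ger0_norm ?subr_ge0//.
  have [m [xm ym mr]] : exists m, [/\ `|a - x| <= m, `|a - y| <= m & m < r].
    by exists (Num.max `|a - x| `|a - y|); rewrite !le_max !lexx orbT gt_max ax.
  apply: le_lt_trans mr; move: `|a - x| `|a - y| xm ym => b c bm cm.
  by nra.
apply: opnorm_le => u u1; set D := \sum_j _; set S := \sum_j _.
have S0 : 0 <= S by apply: sumr_ge0 => j _; exact: normr_ge0.
set v := (A x - A y - D) u.
have [v0|v0] := eqVneq v 0; first by rewrite v0 rnorm0 mulr_ge0// ltW.
have vp : 0 < rnorm v by rewrite rnorm_gt0.
have dg (t : R) : t \in `[0, 1]%R -> is_derive t 1 (fun s : R => rin (A (y + s *: h) u) v)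
    (rin ('D_h A (y + t *: h) u) v).
  by move=> /seg /rB[Bt _]; apply: is_derive_rin; exact: Ad.
have [t t01 gt] := MVT01 dg.
have [Bt Dt] := rB _ (seg t t01).
rewrite -(ler_pM2r vp) -expr2 -rinxx {1}/v.
move: gt; rewrite scale1r scale0r addr0 => gt.
have -> : rin ((A x - A y - D) u) v = rin (('D_h A (y + t *: h) - D) u) v.
  rewrite /= !rinBl; congr (_ - _); rewrite -gt; congr (rin (A _ u) v - _).
  by rewrite /h addrC subrK.
have DD : opnorm ('D_h A (y + t *: h) - D) <= e * S.
  rewrite derive_row; last exact: Ad.
  rewrite /D -sumrB -boundedOp_normE (le_trans (ler_norm_sum _ _ _))//.
  rewrite /S mulr_sumr; apply: ler_sum => j _; rewrite -scalerBr normrZ mulrC.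
  by rewrite ler_wpM2r// distrC ltW.
rewrite (le_trans (ler_rin _ _))// ler_wpM2r ?rnorm_ge0//.
rewrite (le_trans (opnormP _ _))// -[leRHS]mulr1 ler_pM ?opnorm_ge0 ?rnorm_ge0//.
Qed.

End strict_differentiability.

Lemma cvg_fin_sum {R : realType} {V : normedModType R} {T I : Type} (U : set_system T)
  {UF : Filter U} (r : seq I) (f : I -> T -> V) (l : I -> V) :
  (forall i, f i @ U --> l i) ->
  (fun t => \sum_(i <- r) f i t) @ U --> \sum_(i <- r) l i.
Proof.
move=> fl; elim: r => [|i r IH].
  rewrite big_nil (_ : (fun t => _) = fun=> 0); first exact: cvg_cst.
  by apply/funext => t; rewrite big_nil.
rewrite big_cons (_ : (fun t => _) = fun t => f i t + \sum_(i <- r) f i t).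
  by apply: cvgD.
by apply/funext => t; rewrite big_cons.
Qed.

Lemma bounded_ultra_cvg {R : realType} {I : Type} (U : set_system I)
  (UU : UltraFilter U) (f : I -> R) (M : R) :
  (\forall n \near U, `|f n| <= M) -> exists l : R, f @ U --> l.
Proof.
move=> fM; have := @segment_compact R (- M) M; rewrite compact_ultra.
move=> /(_ _ (ultra_fmap UU f)) [|l [_ fl]]; last by exists l.
by apply: filterS fM => n; rewrite /= in_itv /= -ler_norml.
Qed.

Section euclid_norm_theory.
Context {R : realType} {p : nat}.
Implicit Types v : 'rV[R]_p.

Lemma euclid_norm_ge0 v : 0 <= euclid_norm v.
Proof. exact: sqrtr_ge0. Qed.

Lemma ler_coord_euclid_norm v j : `|v ord0 j| <= euclid_norm v.
Proof.
rewrite -sqrtr_sqr ler_wsqrtr// (bigD1 j)//= lerDl.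
by apply: sumr_ge0 => i _; exact: sqr_ge0.
Qed.

Lemma euclid_norm_le_sum v : euclid_norm v <= \sum_j `|v ord0 j|.
Proof.
have S0 : 0 <= \sum_j `|v ord0 j| by apply: sumr_ge0.
rewrite -(ger0_norm S0) -sqrtr_sqr ler_wsqrtr// expr2 mulr_suml.
apply: ler_sum => j _; rewrite -real_normK ?num_real// expr2 ler_wpM2l//.
by rewrite (bigD1 j)//= lerDl sumr_ge0.
Qed.

Lemma euclid_normZ (a : R) v : euclid_norm (a *: v) = `|a| * euclid_norm v.
Proof.
rewrite -sqrtr_sqr /euclid_norm -sqrtrM ?sqr_ge0// mulr_sumr; congr Num.sqrt.
by apply: eq_bigr => j _; rewrite !mxE exprMn.
Qed.

Lemma euclid_norm_gt0 v : v != 0 -> 0 < euclid_norm v.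
Proof.
move=> v0; rewrite lt_def euclid_norm_ge0 andbT; apply: contra_neq v0 => v0.
apply/rowP => j; rewrite mxE; apply/eqP; rewrite -normr_le0 -v0.
exact: ler_coord_euclid_norm.
Qed.

End euclid_norm_theory.

Section singular_spans.
Context {R : realType} {k : scalar_kind} {E F : hilbertType R k}.
Implicit Types T S : boundedOp E F.

Lemma eig_span_sub T (c d : R) : c <= d -> eig_span T d `<=` eig_span T c.
Proof.
move=> cd x [s sP ->]; exists s => // q /sP[dq qe]; split => //.
exact: le_trans dq.
Qed.

Lemma opnorm_adjointB S T : opnorm (adjoint S - adjoint T) <= opnorm (S - T).
Proof.
apply: opnorm_le => y y1; set z := (adjoint S - adjoint T) y.
have [->|z0] := eqVneq z 0; first by rewrite rnorm0 opnorm_ge0.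
have zp : 0 < rnorm z by rewrite rnorm_gt0.
rewrite -(ler_pM2r zp) -expr2 -rinxx {1}/z.
have -> : rin ((adjoint S - adjoint T) y) z = rin y ((S - T) z).
  by rewrite /= rinBl !rin_adjointl -rinBr.
rewrite (le_trans (ler_rin _ _))// -[leRHS]mul1r ler_pM ?rnorm_ge0//.
exact: opnormP.
Qed.

Lemma eig_span_precompact {I : Type} (U : set_system I) (UU : UltraFilter U)
  (Tn : I -> boundedOp E F) T (c M : R) (x : I -> E) :
  0 < c -> compact_op T -> opnorm (Tn n - T) @[n --> U] --> (0 : R) ->
  (forall n, eig_span (Tn n) (c ^+ 2) (x n)) -> (forall n, rnorm (x n) <= M) ->
  exists l, rcvg U x l.
Proof.
move=> c0 Tc TnT xX xM; have c20 : 0 < c ^+ 2 by rewrite exprn_gt0.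
have yex n : exists y, x n = adjoint (Tn n) (Tn n y) /\ rnorm y <= (c ^+ 2)^-1 * M.
  have [y _ [xE yx]] := eig_span_preimage c20 (xX n); exists y; split => //.
  by rewrite (le_trans yx)// ler_wpM2l// invr_ge0 ltW.
have [y yP] := choice yex.
have [g Tyg] : exists g, rcvg U (fun n => T (y n)) g.
  by apply: (compact_op_ultra UU Tc (M := (c ^+ 2)^-1 * M)) => n; have [] := yP n.
have Tny : rcvg U (fun n => Tn n (y n)) g.
  have -> : (fun n => Tn n (y n)) = (fun n => (Tn n - T) (y n) + T (y n)).
    by apply/funext => n; rewrite /= subrK.
  rewrite -[g]add0r; refine (rcvgD _ Tyg).
  have h : (fun n => opnorm (Tn n - T) * ((c ^+ 2)^-1 * M)) @ U --> (0 : R).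
    rewrite -[X in _ --> X](mul0r ((c ^+ 2)^-1 * M)).
    by apply: cvgM => //; exact: cvg_cst.
  refine (cvg0_leW h _) => n; rewrite rnorm_ge0 /= subr0.
  rewrite (le_trans (opnormP (Tn n - T) (y n)))// ler_wpM2l ?opnorm_ge0//.
  by have [] := yP n.
exists (adjoint T g).
have -> : x = (fun n => adjoint (Tn n) (Tn n (y n))).
  by apply/funext => n; have [] := yP n.
refine (rcvg_op _ Tny); refine (cvg0_leW TnT _) => n.
by rewrite opnorm_ge0 opnorm_adjointB.
Qed.

Lemma uniform_eig_span {p : nat} (B : set 'rV[R]_p) (A : 'rV[R]_p -> boundedOp E F)
  (N : nat) (V : 'rV[R]_p -> set E) : (0 < N)%N -> compact B ->
  (forall m, B m -> {for m, continuous A}) ->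
  (forall m, B m -> compact_op (A m)) ->
  (forall m x, B m -> A m x = 0 -> x = 0) ->
  (forall m, B m -> first_singular_space (A m) N (V m)) ->
  exists2 c : R, 0 < c & forall m, B m -> V m `<=` eig_span (A m) (c ^+ 2).
Proof.
move=> N0 Bc Ac Acomp Ainj Vs; apply: contrapT => nc.
have mex (n : nat) : exists m, B m /\ ~ V m `<=` eig_span (A m) (n.+1%:R^-1 ^+ 2).
  apply: contrapT => /forallNP nm; apply: nc; exists n.+1%:R^-1.
    by rewrite invr_gt0.
  by move=> m Bm; apply: contrapT => nV; apply: (nm m).
have [m mP] := choice mex.
have [U [UU Uoo]] := @ultraFilterLemma nat \oo _.
have [a [Ba ma]] : exists a, B a /\ m @ U --> a.
  move: Bc; rewrite compact_ultra => /(_ _ (ultra_fmap UU m)) [|a [Ba ma]].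
    by apply: nearW => n; have [] := mP n.
  by exists a.
have [s s0 [Va _]] := first_singular_bound (fun x => Ainj a x Ba) (Acomp a Ba) N0 (Vs a Ba).
have s2 : 0 < s / 2 by rewrite divr_gt0.
have Am : A (m n) @[n --> U] --> A a by move=> S /(Ac a Ba) /ma.
have h1 : \forall n \near U, `|A a - A (m n)| < s / 2.
  by move: Am => /cvgrPdist_lt; apply.
have h2 : \forall n \near U, n.+1%:R^-1 < s / 2 :> R.
  apply: Uoo; have /cvgr0Pnorm_lt /(_ _ s2) := @cvg_harmonic R.
  by apply: filterS => n /=; rewrite ger0_norm ?invr_ge0.
have /filter_ex[n [/= nA nh]] : U ([set n | `|A a - A (m n)| < s / 2] `&`
  [set n | n.+1%:R^-1 < s / 2 :> R]) by exact: filterI.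
have [Bm] := mP n; apply.
have [sn sn0 [Vm sW]] :=
  first_singular_bound (fun x => Ainj (m n) x Bm) (Acomp _ Bm) N0 (Vs _ Bm).
apply: (subset_trans Vm); apply: eig_span_sub.
rewrite ler_pXn2r ?nnegrE ?invr_ge0 ?(ltW sn0)// (le_trans (ltW nh))//.
apply: (sW (V a) (s / 2)) => [||w Vw]; [by have [] := Vs a Ba|exact: ltW|].
have := eig_span_ge (ltW s0) (Va w Vw).
have := rnormD (A (m n) w) ((A a - A (m n)) w).
have -> : A (m n) w + (A a - A (m n)) w = A a w by rewrite /= addrC subrK.
have := opnormP (A a - A (m n)) w; rewrite -boundedOp_normE => h3 h4 h5.
have : `|A a - A (m n)| * rnorm w <= s / 2 * rnorm w.
  by rewrite ler_wpM2r ?rnorm_ge0// ltW.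
by lra.
Qed.

End singular_spans.

Section singular_sequences.
Context {R : realType} {k : scalar_kind} {E F : hilbertType R k} {p : nat}.
Variables (B' B : set 'rV[R]_p) (A : 'rV[R]_p -> boundedOp E F).
Hypotheses (B'_open : open B') (B_compact : compact B) (B_sub : B `<=` B').
Hypothesis A_compact : forall m, B' m -> compact_op (A m).
Hypothesis A_C1 : C1_on B' A.
Hypothesis cond1 : forall (m m' : 'rV[R]_p) (phi psi : E), B' m -> B' m' ->
  phi != 0 -> A m phi = A m' psi -> m = m' /\ phi = psi.
Hypothesis cond2 : forall m q : 'rV[R]_p, B' m -> euclid_norm q = 1 ->
  injective (fun u : E * E => 'D_q A m u.1 + A m u.2).

Let A_continuous m : B' m -> {for m, continuous A}.
Proof. by move=> /A_C1.1; exact: differentiable_continuous. Qed.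

Lemma derive_eq_range_trivial m q phi x : B' m -> phi != 0 ->
  'D_q A m phi + A m x = 0 -> q = 0.
Proof.
move=> Bm phi0 Dx; apply/eqP/negP => /negP q0.
have qn := euclid_norm_gt0 q0; set s := (euclid_norm q)^-1.
have s0 : 0 < s by rewrite invr_gt0.
have sq : euclid_norm (s *: q) = 1.
  by rewrite euclid_normZ ger0_norm ?(ltW s0)// mulVf ?gt_eqF.
have := cond2 Bm sq (x1 := (phi, s%:K *: x)) (x2 := (0, 0)).
rewrite /= !boundedOp0E addr0 boundedOp_scalable deriveE; last exact: A_C1.1.
rewrite linearZ /= -scalerDr -deriveE; last exact: A_C1.1.
by rewrite Dx scaler0 => /(_ erefl)[/eqP]; rewrite (negPf phi0).
Qed.

Lemma singular_sequence_absurd (c : R) (a b : nat -> 'rV[R]_p) (phi psi : nat -> E) :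
  0 < c -> (forall n, B (a n)) -> (forall n, B (b n)) ->
  (forall n, eig_span (A (a n)) (c ^+ 2) (phi n)) ->
  (forall n, eig_span (A (b n)) (c ^+ 2) (psi n)) ->
  (forall n, rnorm (phi n) + rnorm (psi n) = 1) ->
  (forall n, rnorm (A (a n) (phi n) - A (b n) (psi n)) <
     n.+1%:R^-1 * (rnorm (psi n) * euclid_norm (a n - b n) + rnorm (phi n - psi n))) ->
  False.
Proof.
move=> c0 Ba Bb phiX psiX norm1 small.
have [U [UU Uoo]] := @ultraFilterLemma nat \oo _.
have harm : (fun n : nat => n.+1%:R^-1) @ U --> (0 : R).
  exact: (cvg_sub Uoo (@cvg_harmonic R)).
have Blim (m : nat -> 'rV[R]_p) : (forall n, B (m n)) -> exists l, B l /\ m @ U --> l.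
  move=> Bm; move: B_compact; rewrite compact_ultra.
  move=> /(_ _ (ultra_fmap UU m)) [|l [Bl ml]]; first exact: nearW.
  by exists l.
have Alim (m : nat -> 'rV[R]_p) l : B l -> m @ U --> l ->
    A (m n) @[n --> U] --> A l.
  by move=> Bl ml S /(A_continuous (B_sub Bl)) /ml.
have Alim0 (m : nat -> 'rV[R]_p) l : B l -> m @ U --> l ->
    opnorm (A (m n) - A l) @[n --> U] --> (0 : R).
  by move=> Bl ml; have /subr_cvg0/norm_cvg0P := Alim _ _ Bl ml; exact.
have [al [Bal aal]] := Blim a Ba; have [bl [Bbl bbl]] := Blim b Bb.
have phi1 n : rnorm (phi n) <= 1 by rewrite -(norm1 n) lerDl rnorm_ge0.
have psi1 n : rnorm (psi n) <= 1 by rewrite -(norm1 n) lerDr rnorm_ge0.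
have [phil phiphil] := eig_span_precompact UU c0 (A_compact (B_sub Bal))
  (Alim0 _ _ Bal aal) phiX phi1.
have [psil psipsil] := eig_span_precompact UU c0 (A_compact (B_sub Bbl))
  (Alim0 _ _ Bbl bbl) psiX psi1.
pose tau n := rnorm (psi n) * euclid_norm (a n - b n) + rnorm (phi n - psi n).
have tau_gt0 n : 0 < tau n.
  have := le_lt_trans (rnorm_ge0 _) (small n); rewrite pmulr_rgt0// invr_gt0//.
have coord_cvg (j : 'I_p) : (fun n => (a n - b n) ord0 j) @ U --> (al - bl) ord0 j.
  rewrite (_ : (fun n => _) = fun n => a n ord0 j - b n ord0 j); last first.
    by apply/funext => n; rewrite !mxE.
  rewrite !mxE; apply: cvgB.
    by move=> S Sl; exact: (aal _ (@coord_continuous R 1 p ord0 j al S Sl)).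
  by move=> S Sl; exact: (bbl _ (@coord_continuous R 1 p ord0 j bl S Sl)).
have tau_le n : tau n <= \sum_j `|(a n - b n) ord0 j| + 1.
  rewrite lerD//; last by rewrite -(norm1 n) (le_trans (rnormD _ _))// rnormN.
  rewrite (le_trans _ (euclid_norm_le_sum _))// -[leRHS]mul1r.
  by rewrite ler_wpM2r ?euclid_norm_ge0.
have diff0 : rcvg U (fun n => A (a n) (phi n) - A (b n) (psi n)) 0.
  have h : (fun n => n.+1%:R^-1 * (\sum_j `|(a n - b n) ord0 j| + 1)) @ U --> (0 : R).
    rewrite -[X in _ --> X](mul0r (\sum_j `|(al - bl) ord0 j| + 1)).
    apply: cvgM => //; apply: cvgD; last exact: cvg_cst.
    refine (@cvg_fin_sum R R nat 'I_p U _ _ (fun j n => `|(a n - b n) ord0 j|)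
      (fun j => `|(al - bl) ord0 j|) _) => j.
    exact: cvg_norm (coord_cvg j).
  refine (cvg0_leW h _) => n; rewrite rnorm_ge0 /= subr0.
  by rewrite (le_trans (ltW (small n)))// ler_wpM2l ?invr_ge0//; exact: tau_le.
have Aphi : rcvg U (fun n => A (a n) (phi n)) (A al phil).
  by refine (rcvg_op _ phiphil); exact: Alim0.
have Apsi : rcvg U (fun n => A (b n) (psi n)) (A bl psil).
  by refine (rcvg_op _ psipsil); exact: Alim0.
have Aeq : A al phil = A bl psil.
  apply/eqP; rewrite -subr_eq0; apply/eqP.
  exact: (rcvg_unique (rcvgB Aphi Apsi) diff0).
have norml : rnorm phil + rnorm psil = 1.
  have h1 : (fun n => rnorm (phi n) + rnorm (psi n)) = fun=> 1.
    by apply/funext => n; rewrite norm1.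
  have {}h : (fun n => rnorm (phi n) + rnorm (psi n)) @ U --> rnorm phil + rnorm psil.
    by apply: cvgD; exact: rcvg_rnorm.
  by rewrite h1 in h; refine (cvg_unique _ h (cvg_cst _)).
have [ab phipsi] : al = bl /\ phil = psil.
  have [phi0|phi0] := eqVneq phil 0; last exact: cond1 (B_sub Bal) (B_sub Bbl) phi0 Aeq.
  have [psi0|psi0] := eqVneq psil 0.
    by move: norml; rewrite phi0 psi0 rnorm0 addr0 => /esym/eqP; rewrite oner_eq0.
  by have [-> ->] := cond1 (B_sub Bbl) (B_sub Bal) psi0 (esym Aeq).
have phil2 : rnorm phil = 2^-1 by move: norml; rewrite -phipsi; lra.
have phil0 : phil != 0 by rewrite -rnorm_gt0 phil2 invr_gt0.
rewrite -ab -phipsi in psipsil bbl.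
pose q n := (tau n)^-1 *: (a n - b n).
pose x n := (tau n)^-1%:K *: (phi n - psi n).
pose G n := (tau n)^-1 *: (A (a n) - A (b n)).
have tauV n : 0 <= (tau n)^-1 by rewrite invr_ge0 ltW.
have xE n : rnorm (x n) = (tau n)^-1 * rnorm (phi n - psi n).
  by rewrite rnormZr ger0_norm.
have x1 n : rnorm (x n) <= 1.
  rewrite xE mulrC ler_pdivrMr// mul1r lerDr.
  by rewrite mulr_ge0 ?rnorm_ge0 ?euclid_norm_ge0.
have qE n j : `|q n ord0 j| = (tau n)^-1 * `|(a n - b n) ord0 j|.
  by rewrite [q n _ _]mxE normrM ger0_norm.
have q4 j : \forall n \near U, `|q n ord0 j| <= 4.
  have psin : rnorm (psi n) @[n --> U] --> rnorm phil by exact: rcvg_rnorm.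
  have i4 : 0 < 4^-1 :> R by rewrite invr_gt0.
  move: psin => /cvgrPdist_lt/(_ _ i4); rewrite phil2; apply: filterS => n h.
  have psi4 : 4^-1 <= rnorm (psi n) by move: h; rewrite ltr_norml => /andP[_ h]; lra.
  rewrite qE mulrC ler_pdivrMr// (le_trans (ler_coord_euclid_norm _ _))//.
  have := rnorm_ge0 (phi n - psi n); have := euclid_norm_ge0 (a n - b n).
  by rewrite /tau => e0 d0; nra.
have qlex j : exists l : R, q n ord0 j @[n --> U] --> l.
  have [l ql] := @bounded_ultra_cvg R nat U UU (fun n => q n ord0 j) 4 (q4 j).
  by exists l.
have [ql qlP] := choice qlex.
pose q' := \row_j ql j.
pose D := 'D_q' A al.
have DE : D = \sum_j ql j *: 'D_(delta_mx 0 j) A al.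
  rewrite /D derive_row; last exact/A_C1.1/B_sub.
  by apply: eq_bigr => j _; rewrite mxE.
pose Dn n := \sum_j q n ord0 j *: 'D_(delta_mx 0 j) A al.
have DnD : Dn @ U --> D.
  rewrite DE; apply: (@cvg_fin_sum _ _ _ _ _ _ _
    (fun j n => q n ord0 j *: 'D_(delta_mx 0 j) A al)) => j.
  by apply: cvgZr_tmp => //; exact: qlP.
have GDn : (fun n => G n - Dn n) @ U --> (0 : boundedOp E F).
  apply/cvgr0Pnorm_le => e e0.
  have e1 : 0 < e / (4 * p%:R + 1) by rewrite divr_gt0// ltr_pwDr// mulr_ge0.
  have [r r0 rP] := strict_differentiability B'_open A_C1 (B_sub Bal) e1.
  have h1 : \forall n \near U, `|al - a n| < r by move: aal => /cvgrPdist_lt; apply.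
  have h2 : \forall n \near U, `|al - b n| < r by move: bbl => /cvgrPdist_lt; apply.
  have h3 : \forall n \near U, forall j, `|q n ord0 j| <= 4.
    by have := @filter_forall nat 'I_p (fun j n => `|q n ord0 j| <= 4) U _; apply.
  move: h1 h2 h3; apply: filterS3 => n an bn qn.
  have -> : G n - Dn n = (tau n)^-1 *: (A (a n) - A (b n) -
      \sum_j (a n - b n) ord0 j *: 'D_(delta_mx 0 j) A al).
    rewrite scalerBr scaler_sumr; congr (_ - _); apply: eq_bigr => j _.
    by rewrite scalerA [q n _ _]mxE.
  rewrite normrZ ger0_norm// mulrC ler_pdivrMr// boundedOp_normE (le_trans (rP _ _ an bn))//.
  have -> : \sum_j `|(a n - b n) ord0 j| = tau n * \sum_j `|q n ord0 j|.
    rewrite mulr_sumr; apply: eq_bigr => j _; rewrite qE mulrA mulfV ?mul1r//.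
    by rewrite gt_eqF.
  have sq : \sum_j `|q n ord0 j| <= 4 * p%:R.
    rewrite (le_trans (ler_sum _ (fun j _ => qn j)))//.
    by rewrite sumr_const card_ord mulr_natr.
  rewrite mulrCA mulrC ler_wpM2r ?(ltW (tau_gt0 n))//.
  rewrite mulrAC ler_pdivrMr; last by rewrite ltr_pwDr// mulr_ge0.
  by rewrite ler_wpM2l ?(ltW e0)// (le_trans sq)// lerDl.
have GD : opnorm (G n - D) @[n --> U] --> (0 : R).
  suff /subr_cvg0/norm_cvg0P : G @ U --> D by exact.
  rewrite (_ : G = fun n => (G n - Dn n) + Dn n).
    by rewrite -[X in _ --> X]add0r; apply: cvgD.
  by apply/funext => n; rewrite subrK.
have Axn : rcvg U (fun n => A (a n) (x n) + G n (psi n)) 0.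
  refine (cvg0_leW harm _) => n; rewrite rnorm_ge0 /= subr0.
  have -> : A (a n) (x n) + (tau n)^-1%:K *: (A (a n) (psi n) - A (b n) (psi n)) =
      (tau n)^-1%:K *: (A (a n) (phi n) - A (b n) (psi n)).
    by rewrite /x boundedOp_scalable -scalerDr boundedOpB1 addrA subrK.
  by rewrite rnormZr ger0_norm// mulrC ler_pdivrMr// ltW// small.
have Gpsi : rcvg U (fun n => G n (psi n)) (D phil) by exact: (rcvg_op GD psipsil).
have Aax : rcvg U (fun n => A (a n) (x n)) (- D phil).
  rewrite (_ : (fun n => _) = fun n => (A (a n) (x n) + G n (psi n)) - G n (psi n)).
    by rewrite -[- D phil]add0r; exact: rcvgB.
  by apply/funext => n; rewrite addrK.
have Alx : rcvg U (fun n => A al (x n)) (- D phil).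
  rewrite (_ : (fun n => _) = fun n => A (a n) (x n) - (A (a n) - A al) (x n)).
    rewrite -[- D phil]subr0; refine (rcvgB Aax _).
    refine (cvg0_leW (Alim0 _ _ Bal aal) _) => n; rewrite rnorm_ge0 /= subr0.
    rewrite (le_trans (opnormP (A (a n) - A al) (x n)))// -[leRHS]mulr1.
    by rewrite ler_wpM2l ?opnorm_ge0.
  by apply/funext => n; rewrite /= opprB addrCA subrr addr0.
have [xl xlE] := bounded_range_closed x1 Alx.
have q0 : q' = 0.
  by apply: (derive_eq_range_trivial (B_sub Bal) phil0 (x := xl)); rewrite xlE subrr.
have ql0 j : ql j = 0 by move/rowP/(_ j) : q0; rewrite !mxE.
have D0 : D = 0 by rewrite DE big1// => j _; rewrite ql0 scale0r.
rewrite D0 /= oppr0 in Aax; rewrite D0 in GD.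
have G0 : opnorm (G n) @[n --> U] --> (0 : R).
  by rewrite (_ : (fun n => _) = fun n => opnorm (G n - 0))//; apply/funext => n; rewrite subr0.
have An : opnorm (A (a n)) @[n --> U] --> opnorm (A al).
  exact: (cvg_norm (Alim _ _ Bal aal)).
have Bn : opnorm (A (b n)) @[n --> U] --> opnorm (A al).
  exact: (cvg_norm (Alim _ _ Bal bbl)).
have Ax0 : rnorm (A (a n) (x n)) @[n --> U] --> (0 : R).
  by rewrite -(@rnorm0 R k F); exact: rcvg_rnorm.
have x0 : rnorm (x n) @[n --> U] --> (0 : R).
  pose C n := (2 / c * opnorm (A (a n)) + 1) *
    (2 / c ^+ 2 * (opnorm (A (a n)) + opnorm (A (b n)))).
  have h : (fun n => 2 / c * rnorm (A (a n) (x n)) + C n * opnorm (G n)) @ U --> (0 : R).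
    rewrite -[X in _ --> X]addr0 -[X in _ --> X + _](mulr0 (2 / c)).
    rewrite -[X in _ --> _ + X](mulr0 ((2 / c * opnorm (A al) + 1) *
      (2 / c ^+ 2 * (opnorm (A al) + opnorm (A al))))).
    apply: cvgD; first by apply: cvgM => //; exact: cvg_cst.
    apply: cvgM => //; apply: cvgM; last by apply: cvgM; [exact: cvg_cst|exact: cvgD].
    by apply: cvgD; [apply: cvgM => //; exact: cvg_cst|exact: cvg_cst].
  refine (cvg0_leW h _) => n; rewrite rnorm_ge0 /= xE.
  have := eig_span_dist (A_compact (B_sub (Ba n))) c0 (phiX n) (psiX n).
  rewrite -/(C n) => d.
  have C0 : 0 <= C n.
    rewrite mulr_ge0//; first by rewrite addr_ge0// mulr_ge0 ?opnorm_ge0// divr_ge0// ltW.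
    by rewrite mulr_ge0 ?addr_ge0 ?opnorm_ge0// divr_ge0// sqr_ge0.
  have -> : rnorm (A (a n) (x n)) = (tau n)^-1 * rnorm (A (a n) (phi n - psi n)).
    by rewrite /x boundedOp_scalable rnormZr ger0_norm.
  have -> : opnorm (G n) = (tau n)^-1 * opnorm (A (b n) - A (a n)).
    by rewrite /G opnormZ ger0_norm// -!boundedOp_normE distrC.
  rewrite mulrCA (mulrCA (C n)) -mulrDr ler_wpM2l// (le_trans d)// lerD2l.
  rewrite ler_wpM2l// -[leRHS]mulr1 ler_wpM2l ?opnorm_ge0//.
have : (1 : R) <= 0.
  have h : (fun n => \sum_j `|q n ord0 j| + rnorm (x n)) @ U --> (0 : R).
    rewrite -[X in _ --> X]addr0; apply: cvgD => //.
    rewrite [X in _ --> X](_ : 0 = \sum_(j < p) `|ql j|); last first.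
      by rewrite big1// => j _; rewrite ql0 normr0.
    refine (@cvg_fin_sum R R nat 'I_p U _ _ (fun j n => `|q n ord0 j|)
      (fun j => `|ql j|) _) => j.
    exact: cvg_norm (qlP j).
  refine (cvg_le (cvg_cst _) h _); apply: nearW => n.
  have -> : 1 = (tau n)^-1 * tau n by rewrite mulVf ?gt_eqF.
  rewrite {2}/tau mulrDr xE lerD2r (eq_bigr _ (fun j _ => qE n j)) -mulr_sumr.
  rewrite ler_wpM2l// (le_trans _ (euclid_norm_le_sum _))// -[leRHS]mul1r.
  by rewrite ler_wpM2r ?euclid_norm_ge0.
by rewrite ler10.
Qed.

End singular_sequences.

Theorem theorem2 (R : realType) (k : scalar_kind) (E F : hilbertType R k)
  (p : nat) (B' B : set 'rV[R]_p) (A : 'rV[R]_p -> boundedOp E F)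
  (N : nat) (V : 'rV[R]_p -> set E)
  (B'_open : open B') (B_compact : compact B) (B_sub : B `<=` B')
  (A_compact : forall m, B' m -> compact_op (A m))
  (A_C1 : C1_on B' A)
  (cond1 : forall (m m' : 'rV[R]_p) (phi psi : E), B' m -> B' m' ->
     phi != 0 -> A m phi = A m' psi -> m = m' /\ phi = psi)
  (cond2 : forall m q : 'rV[R]_p, B' m -> euclid_norm q = 1 ->
     injective (fun u : E * E => 'D_q A m u.1 + A m u.2))
  (N_gt0 : (0 < N)%N)
  (V_sing : forall m, B m -> first_singular_space (A m) N (V m)) :
  exists2 C : R, 0 < C &
    forall (m m' : 'rV[R]_p) (phi psi : E), B m -> B m' -> V m phi -> V m' psi ->
      C * (rnorm psi * euclid_norm (m - m') + rnorm (phi - psi))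
        <= rnorm (A m phi - A m' psi).
Proof.
have A_inj m x : B m -> A m x = 0 -> x = 0.
  move=> Bm Ax; apply/eqP/negP => /negP x0.
  have [] := cond1 m m x 0 (B_sub _ Bm) (B_sub _ Bm) x0 _; first by rewrite boundedOp0E.
  by move=> _ x00; rewrite x00 eqxx in x0.
have [c c0 cV] := uniform_eig_span N_gt0 B_compact
  (fun m Bm => differentiable_continuous (A_C1.1 m (B_sub m Bm)))
  (fun m Bm => A_compact m (B_sub m Bm)) A_inj V_sing.
apply: contrapT => nC.
have bad (n : nat) : exists w : ('rV[R]_p * 'rV[R]_p) * (E * E),
    [/\ B w.1.1 /\ B w.1.2, eig_span (A w.1.1) (c ^+ 2) w.2.1,
      eig_span (A w.1.2) (c ^+ 2) w.2.2, rnorm w.2.1 + rnorm w.2.2 = 1 &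
      rnorm (A w.1.1 w.2.1 - A w.1.2 w.2.2) < n.+1%:R^-1 *
        (rnorm w.2.2 * euclid_norm (w.1.1 - w.1.2) + rnorm (w.2.1 - w.2.2))].
  apply: contrapT => /forallNP nw; apply: nC; exists n.+1%:R^-1.
    by rewrite invr_gt0.
  move=> m m' phi psi Bm Bm' Vphi Vpsi; rewrite leNgt; apply/negP => small.
  have [s0|s0] := eqVneq (rnorm phi + rnorm psi) 0.
    have phi0 : phi = 0.
      apply: rnorm0_eq0; have := rnorm_ge0 phi; have := rnorm_ge0 psi; lra.
    have psi0 : psi = 0.
      apply: rnorm0_eq0; have := rnorm_ge0 phi; have := rnorm_ge0 psi; lra.
    move: small; rewrite phi0 psi0 !boundedOp0E !subr0 !rnorm0 mul0r addr0 mulr0.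
    by rewrite ltxx.
  have sp : 0 < rnorm phi + rnorm psi by rewrite lt_def s0 addr_ge0 ?rnorm_ge0.
  set s := (rnorm phi + rnorm psi)^-1.
  have sV : 0 < s by rewrite invr_gt0.
  have eZ T x : eig_span T (c ^+ 2) x -> eig_span T (c ^+ 2) (s%:K *: x).
    by have [_ _ ] := eig_span_subspace T (c ^+ 2); apply.
  apply: (nw ((m, m'), (s%:K *: phi, s%:K *: psi))); split => //=.
  - exact: eZ (cV _ Bm _ Vphi).
  - exact: eZ (cV _ Bm' _ Vpsi).
  - by rewrite !rnormZr (ger0_norm (ltW sV)) -mulrDr mulVf.
  - rewrite !boundedOp_scalable -!scalerBr !rnormZr (ger0_norm (ltW sV)).
    by rewrite -mulrA -mulrDr mulrCA ltr_pM2l.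
have [w wP] := choice bad.
apply: (singular_sequence_absurd B'_open B_compact B_sub A_compact A_C1 cond1 cond2
  (c := c) (a := fun n => (w n).1.1) (b := fun n => (w n).1.2)
  (phi := fun n => (w n).2.1) (psi := fun n => (w n).2.2)) => // n.
all: by have [[]] := wP n.
Qed.
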